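(* Let $$1\to N\to G\xrightarrow{\ \nu\ }\mathbb{Z}\to 1 \qquad\text{and}\qquad 1\to K\to \pi\xrightarrow{\ \chi\ } G\to 1$$ be two group extensions (short exact sequences of groups) such that (i) $b_1(N)<\infty$ and $b_1(K)<\infty$; (ii) $\pi$ is finitely presented and $1$-formal. Then, if the monodromy action of $1\in\mathbb{Z}$ on $H_1(N,\mathbb{C})$ has eigenvalue $1$, the corresponding Jordan blocks are all of size $1$.
   Context: For a group $G$, $b_i(G):=\dim_{\mathbb{C}} H_i(G,\mathbb{C})$ denotes the $i$-th Betti number (homology with trivial coefficients). Monodromy action: given an extension $1\to N\to G\xrightarrow{\nu}\mathbb{Z}\to 1$, the generator $1\in\mathbb{Z}$ acts on $H_1(N,\mathbb{C})$ by $(\iota_g)_*$, where $g\in G$ is any element with $\nu(g)=1$ and $\iota_g$ is the corresponding inner automorphism (conjugation by $g$), restricted to $N$; this is independent of the choice of $g$. $1$-formality: for a finitely generated group $\pi$, the Malcev completion (in the sense of Quillen) is the complete filtered Lie algebra over $\mathbb{Q}$ consisting of the primitive elements of the completed group algebra $\widehat{\mathbb{Q}\pi}=\varprojlim_k \mathbb{Q}\pi/I^k$, where $I$ is the augmentation ideal. The group $\pi$ is called $1$-formal if its Malcev completion is a quadratic complete Lie algebra, i.e., is isomorphic, as a complete filtered Lie algebra, to the degree completion of a quadratic Lie algebra (a quotient of the free Lie algebra on a finite-dimensional $\mathbb{Q}$-vector space placed in degree $1$ by the Lie ideal generated by a set of homogeneous elements of degree $2$). *)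

(* Defs.v *)
From HB Require Import structures.
From mathcomp Require Import all_boot all_order ssralg ssrint rat matrix.
From mathcomp Require Import generic_quotient finmap.
From mathcomp Require Import boolp classical_sets reals.
From mathcomp Require Import complex.
From mathcomp Require Import monalg.

Set Implicit Arguments.
Unset Strict Implicit.
Unset Printing Implicit Defensive.

Import GRing.Theory.
Local Open Scope ring_scope.
Local Open Scope classical_set_scope.
Local Open Scope quotient_scope.

Record subspace (K : fieldType) (V : lmodType K) := Subspace {
  subspace_set :> V -> Prop;
  subspace0 : subspace_set 0;
  subspaceP : forall c x y,
    subspace_set x -> subspace_set y -> subspace_set (c *: x + y)
}.

Section SubspaceTheory.
Variables (K : fieldType) (V : lmodType K) (U : subspace V).

Lemma subspaceD x y : U x -> U y -> U (x + y).
Proof. by move=> Ux Uy; rewrite -[x]scale1r; apply: subspaceP. Qed.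
Lemma subspaceZ c x : U x -> U (c *: x).
Proof. by move=> Ux; rewrite -[_ *: _]addr0; apply/subspaceP/subspace0. Qed.
Lemma subspaceN x : U x -> U (- x).
Proof. by move=> Ux; rewrite -scaleN1r; apply: subspaceZ. Qed.

End SubspaceTheory.

Section QuotientSpace.
Variables (K : fieldType) (V : lmodType K) (U : subspace V).

Definition qequiv (x y : V) : bool := `[< U (x - y) >].

Fact qequiv_is_equiv : equiv_class_of qequiv.
Proof.
split=> [x|x y|y x z].
- by apply/asboolP; rewrite subrr; apply: subspace0.
- by apply/asboolP/asboolP => /subspaceN; rewrite opprB.
- move=> /asboolP xy /asboolP yz; apply/asboolP.
  by rewrite -[x](subrK y) -addrA; apply: subspaceD.
Qed.
Canonical qequiv_equiv := EquivRelPack qequiv_is_equiv.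
Canonical qequiv_encModRel := defaultEncModRel qequiv.

Definition quotspace := {eq_quot qequiv}.
HB.instance Definition _ := Choice.on quotspace.

Definition qproj (x : V) : quotspace := \pi_{eq_quot qequiv} x.

Lemma qprojP x y : qproj x = qproj y <-> U (x - y).
Proof. by split=> [/eqmodP/asboolP //|h]; apply/eqmodP/asboolP. Qed.

Lemma qproj_repr (x : quotspace) : qproj (repr x) = x.
Proof. exact: reprK. Qed.

Lemma qproj_surj (x : quotspace) : exists a, x = qproj a.
Proof. by exists (repr x); rewrite qproj_repr. Qed.

Definition qadd (x y : quotspace) := qproj (repr x + repr y).
Definition qopp (x : quotspace) := qproj (- repr x).

Lemma qaddE x y : qadd (qproj x) (qproj y) = qproj (x + y).
Proof.
by apply/qprojP; rewrite opprD addrACA; apply: subspaceD; apply/qprojP/qproj_repr.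
Qed.
Lemma qoppE x : qopp (qproj x) = qproj (- x).
Proof.
by apply/qprojP; rewrite -opprD; apply: subspaceN; apply/qprojP/qproj_repr.
Qed.

Fact qaddA : associative qadd.
Proof.
move=> x y z; have [a ->] := qproj_surj x; have [b ->] := qproj_surj y.
by have [c ->] := qproj_surj z; rewrite !qaddE addrA.
Qed.
Fact qaddC : commutative qadd.
Proof.
move=> x y; have [a ->] := qproj_surj x; have [b ->] := qproj_surj y.
by rewrite !qaddE addrC.
Qed.
Fact qadd0 : left_id (qproj 0) qadd.
Proof. by move=> x; have [a ->] := qproj_surj x; rewrite qaddE add0r. Qed.
Fact qaddN : left_inverse (qproj 0) qopp qadd.
Proof. by move=> x; have [a ->] := qproj_surj x; rewrite qoppE qaddE addNr. Qed.
HB.instance Definition _ := GRing.isZmodule.Build quotspace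
  qaddA qaddC qadd0 qaddN.

Lemma qprojD x y : qproj (x + y) = qproj x + qproj y.
Proof. by rewrite -qaddE. Qed.

Definition qscale (c : K) (x : quotspace) := qproj (c *: repr x).

Lemma qscaleE c x : qscale c (qproj x) = qproj (c *: x).
Proof. by apply/qprojP; rewrite -scalerBr; apply/subspaceZ/qprojP/qproj_repr. Qed.

Fact qscaleA c d x : qscale c (qscale d x) = qscale (c * d) x.
Proof. by have [a ->] := qproj_surj x; rewrite !qscaleE scalerA. Qed.
Fact qscale1 : left_id 1 qscale.
Proof. by move=> x; have [a ->] := qproj_surj x; rewrite qscaleE scale1r. Qed.
Fact qscaleDr : right_distributive qscale +%R.
Proof.
move=> c x y; have [a ->] := qproj_surj x; have [b ->] := qproj_surj y.
by rewrite -qprojD !qscaleE scalerDr qprojD.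
Qed.
Fact qscaleDl x c d : qscale (c + d) x = qscale c x + qscale d x.
Proof. by have [a ->] := qproj_surj x; rewrite !qscaleE scalerDl qprojD. Qed.

HB.instance Definition _ := GRing.Zmodule_isLmodule.Build K quotspace
  qscaleA qscale1 qscaleDr qscaleDl.

Fact qproj_is_linear : linear qproj.
Proof. by move=> c x y; rewrite qprojD -qscaleE. Qed.
HB.instance Definition _ := GRing.isLinear.Build K V quotspace _ qproj
  qproj_is_linear.

End QuotientSpace.

(* Meaningful when [f] maps [U] into [U']; see [quot_mapE]. *)
Definition quot_map (K : fieldType) (V W : lmodType K) (U : subspace V)
    (U' : subspace W) (f : V -> W) (x : quotspace U) : quotspace U' :=
  qproj U' (f (repr x)).

Lemma quot_mapE (K : fieldType) (V W : lmodType K) (U : subspace V)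
    (U' : subspace W) (f : {linear V -> W}) (x : V) :
    (forall u, U u -> U' (f u)) ->
  quot_map U' f (qproj U x) = qproj U' (f x).
Proof.
by move=> h; apply/qprojP; rewrite -linearB; apply/h/qprojP/qproj_repr.
Qed.

Section LinearAlgebra.
Variables (K : fieldType) (V : lmodType K).

Definition is_basis n (e : 'I_n -> V) : Prop :=
  forall v, exists! c : 'I_n -> K, v = \sum_i c i *: e i.

Definition has_dim n : Prop := exists e : 'I_n -> V, is_basis e.

Definition is_eigenvalue (T : V -> V) (lambda : K) : Prop :=
  exists2 v, v != 0 & T v = lambda *: v.

Definition jordan_block n (lambda : K) : 'M[K]_n :=
  \matrix_(i, j) (lambda *+ (i == j) + (i.+1 == j :> nat)%:R).

(* [e] is a basis in which [T] has the block diagonal matrix with diagonal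
   blocks the Jordan blocks of size [p i] and eigenvalue [l i]. *)
Definition is_jordan_basis (T : V -> V) r (p : 'I_r -> nat) (l : 'I_r -> K)
    (e : 'I_(\sum_i p i) -> V) : Prop :=
  [/\ is_basis e, forall i, (0 < p i)%N &
      forall b, T (e b) =
        \sum_a (\mxdiag_(i < r) jordan_block (p i) (l i)) a b *: e a].

Definition jordan_blocks_of_size1 (T : V -> V) (lambda : K) : Prop :=
  forall r (p : 'I_r -> nat) (l : 'I_r -> K) (e : 'I_(\sum_i p i) -> V),
    is_jordan_basis T l e -> forall i, l i = lambda -> p i = 1%N.

End LinearAlgebra.

Section LinearExtension.
Variables (K : fieldType) (T : choiceType) (V : lmodType K).
Implicit Types (h : T -> V) (a b : {malg K[T]}).

Definition malg_lift h a : V := \sum_(t <- msupp a) a@_t *: h t.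

Lemma malg_liftEw h (d : {fset T}) a : (msupp a `<=` d)%fset ->
  malg_lift h a = \sum_(t <- d) a@_t *: h t.
Proof.
move=> le; rewrite /malg_lift (big_fset_incl _ le) //= => t _ /mcoeff_outdom ->.
by rewrite scale0r.
Qed.

Fact malg_lift_is_linear h : linear (malg_lift h).
Proof.
move=> c a b; pose d := (msupp a `|` msupp b)%fset.
have la : (msupp a `<=` d)%fset by apply: fsubsetUl.
have lb : (msupp b `<=` d)%fset by apply: fsubsetUr.
rewrite (malg_liftEw h la) (malg_liftEw h lb) (@malg_liftEw h d); last first.
  rewrite (fsubset_trans (msuppD_le _ _)) // fsubUset lb andbT.
  exact: fsubset_trans (msuppZ_le _ _) la.
rewrite scaler_sumr -big_split /=; apply: eq_bigr => t _.
by rewrite mcoeffD mcoeffZ scalerDl scalerA.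
Qed.
HB.instance Definition _ h := GRing.isLinear.Build K {malg K[T]} V _
  (malg_lift h) (malg_lift_is_linear h).

Lemma malg_liftU h t : malg_lift h << t >> = h t.
Proof. by rewrite (malg_liftEw h msuppU_le) big_seq_fset1 mcoeffUU scale1r. Qed.

Lemma malg_lift_fD h h' a :
  malg_lift (fun t => h t + h' t) a = malg_lift h a + malg_lift h' a.
Proof.
by rewrite -big_split; apply: eq_bigr => t _ /=; rewrite scalerDr.
Qed.

Lemma malg_lift_fZ c h a : malg_lift (fun t => c *: h t) a = c *: malg_lift h a.
Proof.
by rewrite scaler_sumr; apply: eq_bigr => t _; rewrite !scalerA mulrC.
Qed.

End LinearExtension.

Lemma linear_malg_lift (K : fieldType) (T : choiceType) (V W : lmodType K)
    (f : {linear V -> W}) (h : T -> V) a :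
  f (malg_lift h a) = malg_lift (f \o h) a.
Proof. by rewrite linear_sum; apply: eq_bigr => t _; rewrite linearZ. Qed.

Definition malg_map (K : fieldType) (T T' : choiceType) (f : T -> T') :
    {malg K[T]} -> {malg K[T']} :=
  malg_lift (fun t => << f t >>).
HB.instance Definition _ (K : fieldType) (T T' : choiceType) (f : T -> T') :=
  GRing.Linear.on (@malg_map K T T' f).

HB.mixin Record hasBilinearMul (K : fieldType) A of GRing.Lmodule K A := {
  bmul : A -> A -> A;
  bmulDl : left_distributive bmul +%R;
  bmulDr : right_distributive bmul +%R;
  bmulZl : forall c x y, bmul (c *: x) y = c *: bmul x y;
  bmulZr : forall c x y, bmul x (c *: y) = c *: bmul x y
}.

#[short(type="naAlgType")]
HB.structure Definition NAAlgebra (K : fieldType) :=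
  {A of GRing.Lmodule K A & hasBilinearMul K A}.

Declare Scope na_scope.
Delimit Scope na_scope with NA.
Local Open Scope na_scope.
Notation "x ** y" := (bmul x y) (at level 40, left associativity) : na_scope.

Record ideal (K : fieldType) (A : naAlgType K) := Ideal {
  ideal_subspace :> subspace A;
  idealMl : forall a x, ideal_subspace x -> ideal_subspace (a ** x);
  idealMr : forall a x, ideal_subspace x -> ideal_subspace (x ** a)
}.

Section NAAlgebraTheory.
Variables (K : fieldType) (A : naAlgType K).
Implicit Types x y z : A.

Lemma bmulNl x y : (- x) ** y = - (x ** y).
Proof. by rewrite -scaleN1r bmulZl scaleN1r. Qed.
Lemma bmulNr x y : x ** (- y) = - (x ** y).
Proof. by rewrite -scaleN1r bmulZr scaleN1r. Qed.
Lemma bmulBl x y z : (x - y) ** z = x ** z - y ** z.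
Proof. by rewrite bmulDl bmulNl. Qed.
Lemma bmulBr x y z : x ** (y - z) = x ** y - x ** z.
Proof. by rewrite bmulDr bmulNr. Qed.

End NAAlgebraTheory.

Section IdealGen.
Variables (K : fieldType) (A : naAlgType K) (S : set A).

Definition ideal_gen_set : set A :=
  [set x | forall I : ideal A, (forall s, S s -> I s) -> I x].

Fact ideal_gen0 : ideal_gen_set 0.
Proof. by move=> I _; apply: subspace0. Qed.
Fact ideal_genP c x y :
  ideal_gen_set x -> ideal_gen_set y -> ideal_gen_set (c *: x + y).
Proof. by move=> hx hy I SI; apply: subspaceP; [apply: hx|apply: hy]. Qed.
Fact ideal_genMl a x : ideal_gen_set x -> ideal_gen_set (a ** x).
Proof. by move=> hx I SI; apply/idealMl/hx. Qed.
Fact ideal_genMr a x : ideal_gen_set x -> ideal_gen_set (x ** a).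
Proof. by move=> hx I SI; apply/idealMr/hx. Qed.

Definition ideal_gen : ideal A :=
  @Ideal K A (Subspace ideal_gen0 ideal_genP) ideal_genMl ideal_genMr.

Lemma ideal_gen_sub s : S s -> ideal_gen s.
Proof. by move=> Ss I; apply. Qed.

Lemma ideal_gen_min (I : ideal A) : (forall s, S s -> I s) -> forall x, ideal_gen x -> I x.
Proof. by move=> SI x; apply. Qed.

End IdealGen.

Section IdealPreimage.
Variables (K : fieldType) (A B : naAlgType K) (f : {linear A -> B}).
Hypothesis fM : {morph f : x y / x ** y}.

Lemma ideal_gen_preim (S : set A) (J : ideal B) :
  (forall s, S s -> J (f s)) -> forall x, ideal_gen S x -> J (f x).
Proof.
have P0 : J (f 0) by rewrite linear0; apply: subspace0.
have PP c x y : J (f x) -> J (f y) -> J (f (c *: x + y)).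
  by rewrite linearP => *; apply: subspaceP.
have Ml a x : J (f x) -> J (f (a ** x)) by rewrite fM; apply: idealMl.
have Mr a x : J (f x) -> J (f (x ** a)) by rewrite fM; apply: idealMr.
exact: (@ideal_gen_min _ _ S
  (@Ideal K A (@Subspace K A (fun x => J (f x)) P0 PP) Ml Mr)).
Qed.

End IdealPreimage.

Section QuotientAlgebra.
Variables (K : fieldType) (A : naAlgType K) (I : ideal A).

Definition qmul (x y : quotspace I) := qproj I (repr x ** repr y).

Lemma qmulE x y : qmul (qproj I x) (qproj I y) = qproj I (x ** y).
Proof.
apply/qprojP; set x' := repr _; set y' := repr _.
have hx : I (x' - x) by apply/qprojP/qproj_repr.
have hy : I (y' - y) by apply/qprojP/qproj_repr.
have -> : x' ** y' - x ** y = (x' - x) ** y' + x ** (y' - y).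
  by rewrite bmulBl bmulBr addrA subrK.
by apply: subspaceD; [apply: idealMr|apply: idealMl].
Qed.

Fact qmulDl : left_distributive qmul +%R.
Proof.
move=> x y z; have [a ->] := qproj_surj x; have [b ->] := qproj_surj y.
by have [c ->] := qproj_surj z; rewrite -linearD !qmulE bmulDl linearD.
Qed.
Fact qmulDr : right_distributive qmul +%R.
Proof.
move=> x y z; have [a ->] := qproj_surj x; have [b ->] := qproj_surj y.
by have [c ->] := qproj_surj z; rewrite -linearD !qmulE bmulDr linearD.
Qed.
Fact qmulZl c x y : qmul (c *: x) y = c *: qmul x y.
Proof.
have [a ->] := qproj_surj x; have [b ->] := qproj_surj y.
by rewrite -linearZ !qmulE bmulZl linearZ.
Qed.
Fact qmulZr c x y : qmul x (c *: y) = c *: qmul x y.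
Proof.
have [a ->] := qproj_surj x; have [b ->] := qproj_surj y.
by rewrite -linearZ !qmulE bmulZr linearZ.
Qed.
HB.instance Definition _ := hasBilinearMul.Build K (quotspace I)
  qmulDl qmulDr qmulZl qmulZr.

End QuotientAlgebra.

Section Completion.
Variables (K : fieldType) (A : naAlgType K) (F : nat -> ideal A).

(* The inverse limit of the [A / F k] for a decreasing [F]: the transition map
   [A / F k.+1 -> A / F k] sends the class of [a] to the class of [a]. *)
Record completion := Completion {
  cmpl_val :> forall k, quotspace (F k);
  cmpl_valP : forall k, exists a,
    cmpl_val k.+1 = qproj (F k.+1) a /\ cmpl_val k = qproj (F k) a
}.

HB.instance Definition _ := gen_eqMixin completion.
HB.instance Definition _ := gen_choiceMixin completion.

Lemma cmpl_eqP (x y : completion) : x = y <-> forall k, x k = y k.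
Proof.
split=> [-> //|]; case: x y => [x xP] [y yP] /= e.
have {}e : x = y by apply: functional_extensionality_dep.
by subst y; congr Completion; apply: Prop_irrelevance.
Qed.

Fact cmpl0_compat k : exists a, 0 = qproj (F k.+1) a /\ 0 = qproj (F k) a.
Proof. by exists 0; rewrite !linear0. Qed.
Fact cmpl_add_compat (x y : completion) k : exists a,
  x k.+1 + y k.+1 = qproj (F k.+1) a /\ x k + y k = qproj (F k) a.
Proof.
have [a [-> ->]] := cmpl_valP x k; have [b [-> ->]] := cmpl_valP y k.
by exists (a + b); rewrite !linearD.
Qed.
Fact cmpl_opp_compat (x : completion) k : exists a,
  - x k.+1 = qproj (F k.+1) a /\ - x k = qproj (F k) a.
Proof. by have [a [-> ->]] := cmpl_valP x k; exists (- a); rewrite !linearN. Qed.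
Fact cmpl_scale_compat c (x : completion) k : exists a,
  c *: x k.+1 = qproj (F k.+1) a /\ c *: x k = qproj (F k) a.
Proof.
by have [a [-> ->]] := cmpl_valP x k; exists (c *: a); rewrite !linearZ.
Qed.
Fact cmpl_mul_compat (x y : completion) k : exists a,
  x k.+1 ** y k.+1 = qproj (F k.+1) a /\ x k ** y k = qproj (F k) a.
Proof.
have [a [-> ->]] := cmpl_valP x k; have [b [-> ->]] := cmpl_valP y k.
by exists (a ** b); split; apply: qmulE.
Qed.

Definition cmpl0 := Completion cmpl0_compat.
Definition cmpl_add x y := Completion (cmpl_add_compat x y).
Definition cmpl_opp x := Completion (cmpl_opp_compat x).
Definition cmpl_scale c x := Completion (cmpl_scale_compat c x).
Definition cmpl_mul x y := Completion (cmpl_mul_compat x y).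

Fact cmpl_addA : associative cmpl_add.
Proof. by move=> x y z; apply/cmpl_eqP => k /=; rewrite addrA. Qed.
Fact cmpl_addC : commutative cmpl_add.
Proof. by move=> x y; apply/cmpl_eqP => k /=; rewrite addrC. Qed.
Fact cmpl_add0 : left_id cmpl0 cmpl_add.
Proof. by move=> x; apply/cmpl_eqP => k /=; rewrite add0r. Qed.
Fact cmpl_addN : left_inverse cmpl0 cmpl_opp cmpl_add.
Proof. by move=> x; apply/cmpl_eqP => k /=; rewrite addNr. Qed.
HB.instance Definition _ := GRing.isZmodule.Build completion
  cmpl_addA cmpl_addC cmpl_add0 cmpl_addN.

Fact cmpl_scaleA c d x : cmpl_scale c (cmpl_scale d x) = cmpl_scale (c * d) x.
Proof. by apply/cmpl_eqP => k /=; rewrite scalerA. Qed.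
Fact cmpl_scale1 : left_id 1 cmpl_scale.
Proof. by move=> x; apply/cmpl_eqP => k /=; rewrite scale1r. Qed.
Fact cmpl_scaleDr : right_distributive cmpl_scale +%R.
Proof. by move=> c x y; apply/cmpl_eqP => k /=; rewrite scalerDr. Qed.
Fact cmpl_scaleDl x c d : cmpl_scale (c + d) x = cmpl_scale c x + cmpl_scale d x.
Proof. by apply/cmpl_eqP => k /=; rewrite scalerDl. Qed.
HB.instance Definition _ := GRing.Zmodule_isLmodule.Build K completion
  cmpl_scaleA cmpl_scale1 cmpl_scaleDr cmpl_scaleDl.

Fact cmpl_mulDl : left_distributive cmpl_mul +%R.
Proof. by move=> x y z; apply/cmpl_eqP => k /=; rewrite bmulDl. Qed.
Fact cmpl_mulDr : right_distributive cmpl_mul +%R.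
Proof. by move=> x y z; apply/cmpl_eqP => k /=; rewrite bmulDr. Qed.
Fact cmpl_mulZl c x y : cmpl_mul (c *: x) y = c *: cmpl_mul x y.
Proof. by apply/cmpl_eqP => k /=; rewrite bmulZl. Qed.
Fact cmpl_mulZr c x y : cmpl_mul x (c *: y) = c *: cmpl_mul x y.
Proof. by apply/cmpl_eqP => k /=; rewrite bmulZr. Qed.
HB.instance Definition _ := hasBilinearMul.Build K completion
  cmpl_mulDl cmpl_mulDr cmpl_mulZl cmpl_mulZr.

Definition cmpl_filt k : set completion := [set x | x k = 0].

End Completion.

Section CompletionMap.
Variables (K : fieldType) (A B : naAlgType K).
Variables (F : nat -> ideal A) (F' : nat -> ideal B) (f : {linear A -> B}).
Hypothesis fF : forall k a, F k a -> F' k (f a).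

Fact cmpl_map_compat (x : completion F) k : exists b,
  quot_map (F' k.+1) f (x k.+1) = qproj (F' k.+1) b /\
  quot_map (F' k) f (x k) = qproj (F' k) b.
Proof.
have [a [-> ->]] := cmpl_valP x k; exists (f a).
by rewrite !quot_mapE //; apply: fF.
Qed.

Definition cmpl_map (x : completion F) : completion F' :=
  Completion (cmpl_map_compat x).

End CompletionMap.

Section MagmaAlgebra.
Variables (K : fieldType) (M : ChoiceMagma.type).
Implicit Types a b : {malg K[M]}.

Definition malg_mul a b : {malg K[M]} :=
  malg_lift (fun x => malg_lift (fun y => << (x * y)%g >>) b) a.

Fact malg_mulDl : left_distributive malg_mul +%R.
Proof. by move=> a b c; rewrite /malg_mul linearD. Qed.
Fact malg_mulDr : right_distributive malg_mul +%R.
Proof.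
move=> a b c; rewrite /malg_mul -malg_lift_fD; congr malg_lift.
by apply/funext => x; rewrite linearD.
Qed.
Fact malg_mulZl c a b : malg_mul (c *: a) b = c *: malg_mul a b.
Proof. by rewrite /malg_mul linearZ. Qed.
Fact malg_mulZr c a b : malg_mul a (c *: b) = c *: malg_mul a b.
Proof.
rewrite /malg_mul -malg_lift_fZ; congr malg_lift.
by apply/funext => x; rewrite linearZ.
Qed.
HB.instance Definition _ := hasBilinearMul.Build K (malg M K)
  malg_mulDl malg_mulDr malg_mulZl malg_mulZr.
HB.instance Definition _ := NAAlgebra.on {malg K[M]}.

End MagmaAlgebra.

Lemma malg_mapM (K : fieldType) (M N : ChoiceMagma.type)
    (f : {multiplicative M -> N}) (a b : {malg K[M]}) :
  malg_map f (a ** b) = malg_map f a ** malg_map f b.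
Proof.
rewrite [LHS]linear_malg_lift [RHS](@linear_malg_lift K M _ _ (malg_lift _)).
congr malg_lift; apply/funext => x /=; rewrite malg_liftU !linear_malg_lift.
by congr malg_lift; apply/funext => y /=; rewrite /malg_map !malg_liftU gmulfM.
Qed.

Section AugmentationIdeal.
Variable K : fieldType.

Definition aug (G : groupType) (a : {malg K[G]}) : K :=
  @malg_lift K G K^o (fun=> 1) a.

(* Powers of the augmentation ideal, with [aug_pow G 0] the whole algebra. *)
Fixpoint aug_pow (G : groupType) (k : nat) : ideal {malg K[G]} :=
  match k with
  | 0 => ideal_gen setT
  | k.+1 => ideal_gen [set x | exists a b,
              [/\ aug a = 0, aug_pow G k b & x = a ** b]]
  end.

Lemma malg_map_aug_pow (G H : groupType) (f : {multiplicative G -> H}) k a :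
  aug_pow G k a -> aug_pow H k (malg_map f a).
Proof.
have P (S : set {malg K[G]}) (J : ideal {malg K[H]}) :=
  @ideal_gen_preim _ _ _ (@malg_map K G H f) (malg_mapM f) S J.
elim: k a => [|k IHk] a.
  by apply: (P _ (ideal_gen _)) => x _; apply: ideal_gen_sub.
apply: (P _ (aug_pow H k.+1)) => _ [b [c [b0 hc ->]]].
rewrite /= malg_mapM; apply: ideal_gen_sub.
exists (malg_map f b), (malg_map f c); split=> //; last exact: IHk.
rewrite -[RHS]b0 /aug (@linear_malg_lift K G _ _ (malg_lift _)).
by apply: eq_bigr => x _ /=; rewrite malg_liftU.
Qed.

Definition cgalg (G : groupType) := completion (aug_pow G).

Definition cgalg_map (G H : groupType) (f : {multiplicative G -> H}) :
    cgalg G -> cgalg H :=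
  cmpl_map (f := @malg_map K G H f) (malg_map_aug_pow f).

End AugmentationIdeal.

Section ProductGroup.
Variables G H : groupType.
Local Open Scope group_scope.
Implicit Types x y : G * H.

Definition pg_one : G * H := (1, 1).
Definition pg_inv x : G * H := (x.1^-1, x.2^-1).
Definition pg_mul x y : G * H := (x.1 * y.1, x.2 * y.2).

Fact pg_mulA : associative pg_mul.
Proof. by move=> x y z; rewrite /pg_mul /= !mulgA. Qed.
Fact pg_mul1 : left_id pg_one pg_mul.
Proof. by case=> x y; rewrite /pg_mul /= !mul1g. Qed.
Fact pg_mulr1 : right_id pg_one pg_mul.
Proof. by case=> x y; rewrite /pg_mul /= !mulg1. Qed.
Fact pg_mulV : left_inverse pg_one pg_inv pg_mul.
Proof. by move=> x; rewrite /pg_mul /= !mulVg. Qed.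
Fact pg_mulrV : right_inverse pg_one pg_inv pg_mul.
Proof. by move=> x; rewrite /pg_mul /= !mulgV. Qed.
HB.instance Definition _ := isGroup.Build (G * H)%type
  pg_mulA pg_mul1 pg_mulr1 pg_mulV pg_mulrV.

End ProductGroup.

Section Coproduct.
Variable G : groupType.
Local Open Scope group_scope.

Definition diag_hom (x : G) : G * G := (x, x).
Definition left_hom (x : G) : G * G := (x, 1).
Definition right_hom (x : G) : G * G := (1, x).

Fact diag_homM : {morph diag_hom : x y / x * y}. Proof. by []. Qed.
Fact left_homM : {morph left_hom : x y / x * y}.
Proof. by move=> x y; congr pair; rewrite /= mulg1. Qed.
Fact right_homM : {morph right_hom : x y / x * y}.
Proof. by move=> x y; congr pair; rewrite /= mulg1. Qed.
HB.instance Definition _ := monoid.isMultiplicative.Build G (G * G)%type diag_hom diag_homM.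
HB.instance Definition _ := monoid.isMultiplicative.Build G (G * G)%type left_hom left_homM.
HB.instance Definition _ := monoid.isMultiplicative.Build G (G * G)%type right_hom right_homM.

End Coproduct.

(* The completed tensor square of the completed group algebra is identified
   with the completed group algebra of [G * G], through [K[G] (x) K[G] = K[G * G]],
   under which [\sum_(p + q = k) I^p (x) I^q] is the [k]-th power of the
   augmentation ideal. The completed coproduct is then induced by the diagonal,
   and [x |-> x (x) 1], [x |-> 1 (x) x] by the two inclusions of factors. *)
Definition malcev (K : fieldType) (G : groupType) : set (cgalg K G) :=
  [set x | cgalg_map (@diag_hom G) x =
           cgalg_map (@left_hom G) x + cgalg_map (@right_hom G) x].

Inductive free_magma (n : nat) :=
  | Leaf of 'I_n
  | Node of free_magma n & free_magma n.

HB.instance Definition _ n := gen_eqMixin (free_magma n).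
HB.instance Definition _ n := gen_choiceMixin (free_magma n).
HB.instance Definition _ n := hasMul.Build (free_magma n) (@Node n).

Fixpoint leaves n (t : free_magma n) : nat :=
  match t with Leaf _ => 1%N | Node l r => (leaves l + leaves r)%N end.

Section FreeLie.
Variables (K : fieldType) (n : nat).

Definition lie_axioms : set {malg K[free_magma n]} :=
  [set a | (exists x, a = x ** x) \/
           (exists x y z, a = x ** (y ** z) + y ** (z ** x) + z ** (x ** y))].

(* The free Lie algebra on an [n]-dimensional space in degree 1: free
   non-associative algebra modulo alternation and the Jacobi identity. *)
Definition free_lie := quotspace (ideal_gen lie_axioms).
HB.instance Definition _ := NAAlgebra.on free_lie.

Definition free_lie_homog (k : nat) : set free_lie :=
  [set x | exists2 a : {malg K[free_magma n]},
     (forall t, t \in msupp a -> leaves t = k) & x = qproj _ a].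

Definition quad_lie (R : set free_lie) := quotspace (ideal_gen R).

Definition quad_lie_filt (R : set free_lie) (k : nat) : ideal (quad_lie R) :=
  ideal_gen [set x | exists j (y : free_lie),
    [/\ (k <= j)%N, free_lie_homog j y & x = qproj _ y]].

End FreeLie.

(* The completion of [quad_lie R] along its degree filtration is isomorphic, as
   a filtered Lie algebra, to the primitive elements with the commutator
   bracket. The bracket of [quad_lie R] is [**]. *)
Definition one_formal (G : groupType) : Prop :=
  exists n (R : set (free_lie rat n)),
    R `<=` @free_lie_homog rat n 2 /\
    exists f : {linear completion (quad_lie_filt R) -> cgalg rat G},
      [/\ injective f,
          range f = @malcev rat G,
          forall x y, f (x ** y) = f x ** f y - f y ** f x &
          forall k x, cmpl_filt k x <-> cmpl_filt k (f x)].

Section H1.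
Variables (K : fieldType) (G : groupType).

(* Bar complex with trivial coefficients in degrees [2 -> 1 -> 0]; there
   [d [g|h] = [h] - [gh] + [g]] and [d [g] = 0], so that all 1-chains are cycles. *)
Definition bar_d2 : {malg K[(G * G)%type]} -> {malg K[G]} :=
  malg_lift (fun p => << p.2 >> - << (p.1 * p.2)%g >> + << p.1 >>).

Fact boundary1_0 : range bar_d2 0.
Proof. by exists 0 => //; rewrite /bar_d2 linear0. Qed.
Fact boundary1_P c x y :
  range bar_d2 x -> range bar_d2 y -> range bar_d2 (c *: x + y).
Proof.
by move=> [a _ <-] [b _ <-]; exists (c *: a + b) => //; rewrite /bar_d2 linearP.
Qed.
Definition boundary1 : subspace {malg K[G]} := Subspace boundary1_0 boundary1_P.

Definition H1 := quotspace boundary1.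
HB.instance Definition _ := GRing.Lmodule.on H1.

End H1.

Definition H1_map (K : fieldType) (G H : groupType)
    (f : {multiplicative G -> H}) : H1 K G -> H1 K H :=
  quot_map (boundary1 K H) (malg_map f).

Lemma H1_mapE (K : fieldType) (G H : groupType) (f : {multiplicative G -> H}) a :
  H1_map f (qproj (boundary1 K G) a) = qproj (boundary1 K H) (malg_map f a).
Proof.
rewrite /H1_map (quot_mapE (U' := boundary1 K H) (f := malg_map f)) //.
move=> _ [c _ <-]; exists (malg_map (fun p => (f p.1, f p.2)) c) => //.
rewrite /bar_d2 /malg_map !linear_malg_lift.
apply: eq_bigr => -[x y] _ /=.
congr (_ *: _); rewrite [LHS]malg_liftU /malg_map linearD linearB /=.
by rewrite !malg_liftU gmulfM.
Qed.
Arguments H1_map K {G H} f x.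

Definition b1_finite (K : fieldType) (G : groupType) : Prop :=
  exists n, has_dim (H1 K G) n.

Definition short_exact (N G Q : groupType) (i : N -> G) (p : G -> Q) : Prop :=
  [/\ injective i, forall q, exists g, p g = q &
      forall g, p g = 1%g <-> exists m, i m = g].

Definition infcyc : groupType := Algebra.to_multiplicative int.

Section Presentation.
Variables (n : nat) (G : groupType).

(* The letter [(i, true)] stands for the [i]-th generator, [(i, false)] for its
   inverse. *)
Definition word := seq ('I_n * bool).

Definition word_val (x : 'I_n -> G) (w : word) : G :=
  (\prod_(l <- w) if l.2 then x l.1 else (x l.1)^-1)%g.

(* Equality of words in the group presented by the relators [r]. *)
Inductive word_eq (r : seq word) : word -> word -> Prop :=
  | word_refl u : word_eq r u u
  | word_sym u v : word_eq r u v -> word_eq r v u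
  | word_trans u v w : word_eq r u v -> word_eq r v w -> word_eq r u w
  | word_cancel u v i b : word_eq r (u ++ [:: (i, b); (i, ~~ b)] ++ v) (u ++ v)
  | word_rel u v w : w \in r -> word_eq r (u ++ w ++ v) (u ++ v).

End Presentation.

Definition finitely_presented (G : groupType) : Prop :=
  exists n (x : 'I_n -> G) (r : seq (word n)),
    (forall g, exists w, word_val x w = g) /\
    (forall u v, word_val x u = word_val x v <-> word_eq r u v).

(* Main.v *)
Require Import Defs.
From HB Require Import structures.
From mathcomp Require Import all_boot all_order all_algebra.
From mathcomp Require Import generic_quotient finmap.
From mathcomp Require Import boolp classical_sets functions reals complex monalg.
From mathcomp Require Import zify.

(* Let [pi ->> Z] be the composite, with kernel [M], and suppose that there is a
   Jordan block of size at least [2]. Two of its coordinate functionals are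
   homomorphisms [a], [b] on [N] with [a] invariant and [b] mapped to [b + a] by the
   monodromy; they give [alpha], [beta] on [pi] with
   [beta (x y) = beta x + beta y + chi x alpha y], so that the cup product of [chi] and
   [alpha] vanishes. As the Malcev Lie algebra is quadratic, this is all that is needed
   to represent it in the Lie algebra of the line [x] acting on [V[x]] by
   multiplication, [x] having coefficient [chi] and [V] coefficient [alpha]. Composing
   with [log : pi -> malcev pi], the coefficients [u_0 = alpha, u_1, ...] of [V[x]]
   become homomorphisms on [M], and the derivative at [m = 0] of
   [u_(k+1) (t^m g t^-m)] is [u_k g] when [chi t = 1], which makes the [u_k]
   independent. But [M] is an extension of [N] by [K], so [b_1(M)] is finite.

   The Baker-Campbell-Hausdorff formula is avoided: [u_k] is additive on [M] because it
   is a polynomial class function on [M] which is homogeneous on powers. *)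

Set Implicit Arguments.
Unset Strict Implicit.
Unset Printing Implicit Defensive.

Import GRing.Theory Num.Theory.
Local Open Scope ring_scope.
Local Open Scope na_scope.

(** * Polynomial sequences and their derivative at zero *)

(** The logarithm is handled through sequences instead of power series. Modulo I^d, with I the
    augmentation ideal, n |-> x^n = \sum_i C(n,i) (x - 1)^i is polynomial in n, and log x is its
    derivative at n = 0. Statements on powers, conjugation and primitivity then become first-order
    computations with polynomial sequences; commutators matter only when (x z)^n is compared with
    x^n z^n.

    A block of size 2 already yields chains of every length because a relation of degree 2 tests
    only the coefficient of x^1, whatever happens in higher powers of x.

    Two ground fields are present: the Malcev Lie algebra is rational, whereas independence is
    needed over the field in which b_1 is taken. Hence the u_k take values in an arbitrary rational
    vector space V, later the field itself. *)

Definition fdiff (V : zmodType) (s : nat -> V) : nat -> V :=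
  fun n => s n.+1 - s n.

Definition binpoly (i : nat) : {poly rat} :=
  (i`!%:R)^-1 *: \prod_(j < i) ('X - (j%:R)%:P).

(** For [i > 0] this is (-1)^(i-1) / i, the coefficient of X^i in log(1 + X): differentiate (1 +
    X)^n = \sum_i C(n,i) X^i at n = 0. *)
Definition log_coef (i : nat) : rat := (binpoly i)`_1.

(* On a sequence [s] with [i]-th differences vanishing for [i >= d], hence
   polynomial in [n], this is the derivative of [s] at [n = 0]. *)
Definition deriv_at0 (V : lmodType rat) (d : nat) (s : nat -> V) : V :=
  \sum_(i < d) log_coef i *: iter i (@fdiff V) s 0%N.

Lemma horner_binpoly i n : (binpoly i).[n%:R] = 'C(n, i)%:R.
Proof.
rewrite /binpoly hornerZ horner_prod.
have -> : \prod_(j < i) ('X - (j%:R)%:P).[n%:R] = (n ^_ i)%:R :> rat.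
  elim: i => [|i IH]; first by rewrite big_ord0 ffactn0.
  rewrite big_ord_recr /= IH ffactnSr natrM hornerXsubC.
  case: (leqP i n) => h; first by rewrite natrB.
  by rewrite ffact_small // !mul0r.
by rewrite -bin_ffact natrM mulrC mulfK // pnatr_eq0 -lt0n fact_gt0.
Qed.

Lemma size_binpoly i : size (binpoly i) = i.+1.
Proof.
rewrite size_scale ?invr_eq0 ?pnatr_eq0 -?lt0n ?fact_gt0 //.
by rewrite size_prod_XsubC /index_enum -enumT size_enum_ord.
Qed.

Lemma binpoly0 : binpoly 0 = 1.
Proof. by rewrite /binpoly big_ord0 fact0 invr1 scale1r. Qed.

Lemma log_coef0 : log_coef 0 = 0.
Proof. by rewrite /log_coef binpoly0 coef1. Qed.

Lemma log_coef1 : log_coef 1 = 1.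
Proof.
by rewrite /log_coef /binpoly big_ord1 factS fact0 invr1 scale1r subr0 coefX.
Qed.

Section Sequences.
Variable V : lmodType rat.
Implicit Types (s t : nat -> V) (w : V).

Lemma iter_fdiffSr i s n :
  iter i.+1 (@fdiff V) s n = iter i (@fdiff V) s n.+1 - iter i (@fdiff V) s n.
Proof. by []. Qed.

Lemma iter_fdiffD i s t n :
  iter i (@fdiff V) (fun n => s n + t n) n =
  iter i (@fdiff V) s n + iter i (@fdiff V) t n.
Proof.
elim: i n => [|i IH] n //; rewrite !iter_fdiffSr !IH.
by rewrite opprD addrACA.
Qed.

Lemma iter_fdiff_linear (W : lmodType rat) (f : {linear V -> W}) i s n :
  iter i (@fdiff W) (f \o s) n = f (iter i (@fdiff V) s n).
Proof. by elim: i n => [|i IH] n //; rewrite !iter_fdiffSr iterS /fdiff !IH linearB. Qed.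

Lemma iter_fdiff_bin k i w n :
  iter k (@fdiff V) (fun n => 'C(n, i + k)%:R *: w) n = 'C(n, i)%:R *: w.
Proof.
elim: k i n => [|k IH] i n; first by rewrite addn0.
rewrite iter_fdiffSr addnS -addSn !IH -scalerBl binS natrD [X in X - _]addrC.
by rewrite addrK.
Qed.

Lemma iter_fdiff_bin0 k i w :
  iter k (@fdiff V) (fun n => 'C(n, i)%:R *: w) 0%N = (k == i)%:R *: w.
Proof.
case: (leqP k i) => h.
  by rewrite -{1}(subnK h) iter_fdiff_bin bin0n subn_eq0 eqn_leq h.
rewrite gtn_eqF // scale0r -(subnKC h) addnC iterD.
have z m s : (forall n, s n = 0) -> forall n, iter m (@fdiff V) s n = 0.
  by move=> h0; elim: m => [|m IH] n //; rewrite iter_fdiffSr !IH subr0.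
apply: z => n; have := iter_fdiff_bin i 0 w; rewrite add0n => e.
by rewrite iter_fdiffSr !e !bin0 subrr.
Qed.

Lemma newton s n N : (n < N)%N ->
  s n = \sum_(i < N) 'C(n, i)%:R *: iter i (@fdiff V) s 0%N.
Proof.
elim: n s N => [|n IH] s N h.
  case: N h => // N _; rewrite big_ord_recl big1 ?addr0 ?bin0 ?scale1r // => i _.
  by rewrite bin0n scale0r.
have e : s n.+1 = s n + fdiff s n by rewrite /fdiff addrC subrK.
case: N h => // N h; rewrite {}e (IH s N.+1); last exact: ltnW.
rewrite (IH (fdiff s) N) // !big_ord_recl !bin0 -addrA -big_split /=.
congr (_ + _); apply: eq_bigr => i _.
by rewrite /bump /= add1n binS natrD scalerDl -iterSr.
Qed.

Lemma eq_deriv_at0 d s t : (forall n, s n = t n) -> deriv_at0 d s = deriv_at0 d t.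
Proof. by move=> e; rewrite (_ : s = t) //; apply/funext. Qed.

Lemma deriv_at0D d s t : deriv_at0 d (fun n => s n + t n) = deriv_at0 d s + deriv_at0 d t.
Proof.
by rewrite /deriv_at0 -big_split; apply: eq_bigr => i _; rewrite iter_fdiffD scalerDr.
Qed.

Lemma deriv_at0_linear (W : lmodType rat) (f : {linear V -> W}) d s :
  deriv_at0 d (f \o s) = f (deriv_at0 d s).
Proof.
by rewrite linear_sum; apply: eq_bigr => i _; rewrite iter_fdiff_linear linearZ.
Qed.

Lemma deriv_at0_bin d i w : (i < d)%N ->
  deriv_at0 d (fun n => 'C(n, i)%:R *: w) = log_coef i *: w.
Proof.
move=> h; rewrite /deriv_at0 (bigD1 (Ordinal h)) //= iter_fdiff_bin0 eqxx scale1r.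
rewrite big1 ?addr0 // => j /negPf; rewrite -val_eqE /= iter_fdiff_bin0 => ->.
by rewrite scale0r scaler0.
Qed.

Lemma deriv_at0_const d w : deriv_at0 d (fun=> w) = 0.
Proof.
case: d => [|d]; first by rewrite /deriv_at0 big_ord0.
rewrite (@eq_deriv_at0 _ _ (fun n => 'C(n, 0)%:R *: w)); last first.
  by move=> n; rewrite bin0 scale1r.
by rewrite deriv_at0_bin // log_coef0 scale0r.
Qed.

Lemma deriv_at0_sum d (I : Type) (r : seq I) (s : I -> nat -> V) :
  deriv_at0 d (fun n => \sum_(i <- r) s i n) = \sum_(i <- r) deriv_at0 d (s i).
Proof.
elim: r => [|i r IH].
  rewrite big_nil -[RHS](deriv_at0_const d 0); apply: eq_deriv_at0 => n; exact: big_nil.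
rewrite big_cons -IH -deriv_at0D; apply: eq_deriv_at0 => n; exact: big_cons.
Qed.

(** There is one [binpoly m] in each degree, so subtracting a multiple of it removes the leading
    term of [p] and leaves [deriv_at0_bin] to conclude. *)
Lemma deriv_at0_poly d (p : {poly rat}) w : (size p <= d)%N ->
  deriv_at0 d (fun n => p.[n%:R] *: w) = p`_1 *: w.
Proof.
move: p; suff H m : (m <= d)%N -> forall p : {poly rat}, (size p <= m)%N ->
    deriv_at0 d (fun n => p.[n%:R] *: w) = p`_1 *: w by move=> p; apply: H.
elim: m => [|m IH] hm p hp.
  have -> : p = 0 by apply/eqP; rewrite -size_poly_leq0.
  rewrite coef0 scale0r -[RHS](deriv_at0_const d 0); apply: eq_deriv_at0 => n.
  by rewrite horner0 scale0r.
pose c := p`_m / (binpoly m)`_m.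
pose q := p - c *: binpoly m.
have bm : (binpoly m)`_m != 0.
  have : lead_coef (binpoly m) != 0 by rewrite lead_coef_eq0 -size_poly_eq0 size_binpoly.
  by rewrite lead_coefE size_binpoly.
have hq : (size q <= m)%N.
  apply/leq_sizeP => j; rewrite leq_eqVlt => /orP[/eqP <-|hj].
    by rewrite coefB coefZ divfK ?subrr.
  rewrite coefB coefZ !nth_default ?mulr0 ?subrr //; last exact: leq_trans hp hj.
  by rewrite size_binpoly.
have -> : p = q + c *: binpoly m by rewrite subrK.
rewrite coefD coefZ -/(log_coef m) scalerDl -(IH (ltnW hm) q) //.
rewrite (mulrC c) -[in RHS]scalerA -(deriv_at0_bin _ hm) -deriv_at0D; apply: eq_deriv_at0 => n.
by rewrite hornerD hornerZ scalerDl horner_binpoly mulrC scalerA.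
Qed.

Lemma deriv_at0_id d w : (1 < d)%N -> deriv_at0 d (fun n => n%:R *: w) = w.
Proof.
move=> h; rewrite (@eq_deriv_at0 _ _ (fun n => 'C(n, 1)%:R *: w)).
  by rewrite deriv_at0_bin // log_coef1 scale1r.
by move=> n; rewrite bin1.
Qed.

(* Leibniz rule: only the terms [i = 0] and [j = 0] of the double expansion
   have a nonzero linear part. *)
Lemma deriv_at0_diag d (s : nat -> nat -> V) (W : nat -> nat -> V) :
  (forall i j, (d <= i + j)%N -> W i j = 0) ->
  (forall a b N, (a < N)%N -> (b < N)%N -> s a b =
    \sum_(i < N) \sum_(j < N) ('C(a, i) * 'C(b, j))%:R *: W i j) ->
  deriv_at0 d (fun n => s n n) =
  deriv_at0 d (fun n => s n 0%N) + deriv_at0 d (fun n => s 0%N n).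
Proof.
move=> W0 sE.
(* The sums are cut to a fixed [d] by [d] square, outside which [W] vanishes, so that they can be
   differentiated term by term. *)
have {}sE a b : s a b =
    \sum_(i < d) \sum_(j < d) ('C(a, i) * 'C(b, j))%:R *: W i j.
  pose N := (d + (a.+1 + b.+1))%N.
  have le_d : (d <= N)%N by apply: leq_addr.
  rewrite (sE a b N); try by rewrite /N; lia.
  rewrite [RHS](big_ord_widen _ (fun i => \sum_(j < d) ('C(a, i) * 'C(b, j))%:R *: W i j) le_d) /=.
  rewrite [RHS]big_mkcond; apply: eq_bigr => i _; case: ltnP => hi; last first.
    rewrite big1 // => j _; rewrite W0 ?scaler0 //; exact: leq_trans hi (leq_addr _ _).
  rewrite [RHS](big_ord_widen _ (fun j => ('C(a, i) * 'C(b, j))%:R *: W i j) le_d) [RHS]big_mkcond.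
  apply: eq_bigr => j _; case: ltnP => hj //; rewrite W0 ?scaler0 //.
  exact: leq_trans hj (leq_addl _ _).
have dE (f : nat -> nat -> nat -> nat) : deriv_at0 d (fun n =>
    \sum_(i < d) \sum_(j < d) (f n i j)%:R *: W i j) =
    \sum_(i < d) \sum_(j < d) deriv_at0 d (fun n => (f n i j)%:R *: W i j).
  rewrite deriv_at0_sum; apply: eq_bigr => i _; exact: deriv_at0_sum.
rewrite (eq_deriv_at0 _ (fun n => sE n n)) (eq_deriv_at0 _ (fun n => sE n 0%N)).
rewrite (eq_deriv_at0 _ (fun n => sE 0%N n)).
rewrite (dE (fun n i j => 'C(n, i) * 'C(n, j)))%N.
rewrite (dE (fun n i j => 'C(n, i) * 'C(0, j)))%N.
rewrite (dE (fun n i j => 'C(0, i) * 'C(n, j)))%N.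
rewrite -big_split; apply: eq_bigr => i _; rewrite -big_split; apply: eq_bigr => j _ /=.
(* When [i + j < d], the product [binpoly i * binpoly j] has size [i + j + 1 <= d], small enough for
   [deriv_at0_poly]. *)
have [/W0 W0ij|hij] := leqP d (i + j).
  have z (f : nat -> nat) : deriv_at0 d (fun n => (f n)%:R *: W i j) = 0.
    by rewrite -[RHS](deriv_at0_const d 0); apply: eq_deriv_at0 => n; rewrite W0ij scaler0.
  by rewrite !z addr0.
pose c n i := 'C(n, i)%:R *: W i j.
have p1 (p q : {poly rat}) : (p * q)`_1 = p`_0 * q`_1 + p`_1 * q`_0.
  by rewrite coefM big_ord_recr big_ord1.
have cf0 k : (binpoly k)`_0 = 'C(0, k)%:R.
  by rewrite -horner_coef0 -[0](mulr0n 1) horner_binpoly.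
transitivity ((binpoly i * binpoly j)`_1 *: W i j).
  rewrite -(@deriv_at0_poly d); last first.
    by rewrite size_mul -?size_poly_eq0 ?size_binpoly //= addnS.
  by apply: eq_deriv_at0 => n; rewrite hornerM !horner_binpoly natrM.
rewrite p1 !cf0 -/(log_coef i) -/(log_coef j) scalerDl [LHS]addrC; congr (_ + _).
  rewrite -scalerA -(deriv_at0_bin _ (ltn_ord i)).
  by apply: eq_deriv_at0 => n; rewrite natrM scalerA.
rewrite mulrC -scalerA -(deriv_at0_bin _ (ltn_ord j)).
by apply: eq_deriv_at0 => n; rewrite mulnC natrM scalerA.
Qed.

(** Let D be the difference operator, nilpotent on [s]. The derivative is D + c_2 D^2 + ..., which
    is D times an invertible operator, so its vanishing at every point forces D s = 0. *)
Lemma deriv_at0_shift_eq0 d s :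
    (forall a, iter d (@fdiff V) s a = 0) ->
    (forall a, deriv_at0 d (fun n => s (a + n)%N) = 0) ->
  forall a, s a = s 0%N.
Proof.
have shift i a : iter i (@fdiff V) (fun n => s (a + n)%N) 0%N = iter i (@fdiff V) s a.
  rewrite -[a in RHS]addn0; elim: i (0)%N => [|i IH] n //.
  by rewrite !iter_fdiffSr !IH addnS.
move=> sd s0.
suff H i : (0 < i)%N -> (i <= d)%N -> forall a, iter i (@fdiff V) s a = 0.
  have h1 a : s a.+1 = s a.
    apply/eqP; rewrite -subr_eq0; apply/eqP; case: d {s0} sd H => [|d] sd H.
      by have := sd a; have := sd a.+1 => /= -> ->; rewrite subr0.
    exact: (H 1%N).
  by elim=> [|a IH] //; rewrite h1.
(* Descending induction from D^d s = 0 to D s = 0. *)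
elim: {i}(d - i)%N {-2}i (erefl (d - i)%N) => [|k IH] i e i0 ile a.
  by have -> : i = d by lia.
have ii a' : iter i.+1 (@fdiff V) s a' = 0 by apply: IH; lia.
have hi m a' : (i < m)%N -> iter m (@fdiff V) s a' = 0.
  move=> /subnKC <-; rewrite addnC iterD.
  elim: (m - i.+1)%N a' => [|l IHl] a'; first exact: ii.
  by rewrite iter_fdiffSr !IHl subr0.
(* Apply D^(i-1) to the vanishing derivative: the term [l = 0] has coefficient 0, [l = 1] gives D^i
   s, and the terms with [l > 1] are already known to vanish. *)
have : iter i.-1 (@fdiff V) (fun a => deriv_at0 d (fun n => s (a + n)%N)) a = 0.
  elim: (i.-1) a => [|l IHl] a'; first exact: s0.
  by rewrite iter_fdiffSr !IHl subr0.
have -> : (fun a => deriv_at0 d (fun n => s (a + n)%N)) =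
    (fun a => \sum_(l < d) log_coef l *: iter l (@fdiff V) s a).
  by apply/funext => a'; apply: eq_bigr => l _; rewrite shift.
have -> : iter i.-1 (@fdiff V)
    (fun a => \sum_(l < d) log_coef l *: iter l (@fdiff V) s a) a =
    \sum_(l < d) log_coef l *: iter (i.-1 + l) (@fdiff V) s a.
  elim: (i.-1) a => [|m IHm] a'; first by [].
  rewrite iter_fdiffSr !IHm -sumrB; apply: eq_bigr => l _.
  by rewrite -scalerBr addSn iter_fdiffSr.
have d1 : (1 < d)%N by lia.
rewrite (bigD1 (Ordinal d1)) //= log_coef1 scale1r addn1 prednK // big1 ?addr0 //.
move=> l hl; case: (posnP l) => [->|l0]; first by rewrite log_coef0 scale0r.
have l1 : (l : nat) <> 1%N by move=> h; case/eqP: hl; apply: val_inj.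
by rewrite hi ?scaler0 //; lia.
Qed.

End Sequences.

(** * Powers of the augmentation ideal *)

Section MalgLift.
Variables (K : fieldType) (T : choiceType).

Lemma malg_lift_id (a : {malg K[T]}) : malg_lift (fun t => << t >>) a = a.
Proof.
rewrite [RHS]monalgE /malg_lift; apply: eq_bigr => t _.
apply/malgP => u; rewrite mcoeffZ !mcoeffU.
by case: eqP => _; rewrite ?mulr1n ?mulr1 ?mulr0n ?mulr0.
Qed.

Lemma malg_lift_eq_in (V : lmodType K) (h h' : T -> V) (a : {malg K[T]}) :
  (forall t, t \in msupp a -> h t = h' t) -> malg_lift h a = malg_lift h' a.
Proof. by move=> e; rewrite /malg_lift; apply: eq_big_seq => t /e ->. Qed.

Lemma malg_lift_eq0 (V : lmodType K) (h : T -> V) (a : {malg K[T]}) :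
  (forall t, t \in msupp a -> h t = 0) -> malg_lift h a = 0.
Proof.
by move/malg_lift_eq_in ->; apply: big1 => t _; rewrite scaler0.
Qed.

Lemma malg_linear_ext (V : lmodType K) (f g : {linear {malg K[T]} -> V}) :
  (forall t, f << t >> = g << t >>) -> f =1 g.
Proof.
move=> e a; rewrite -[a]malg_lift_id !linear_malg_lift; congr malg_lift.
exact/funext.
Qed.

Lemma malg_subspace_ind (U : subspace {malg K[T]}) :
  (forall t, U << t >>) -> forall a, U a.
Proof.
move=> h a; rewrite -[a]malg_lift_id /malg_lift.
elim/big_ind: _ => [|x y|t _]; [exact: subspace0 | exact: subspaceD |].
exact: subspaceZ.
Qed.

End MalgLift.

Section BilinearMaps.
Variables (K : fieldType) (A : naAlgType K).

Definition lmul_by (a x : A) : A := a ** x.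
Definition rmul_by (a x : A) : A := x ** a.

Fact lmul_by_is_linear a : linear (lmul_by a).
Proof. by move=> c x y; rewrite /lmul_by bmulDr bmulZr. Qed.
HB.instance Definition _ a :=
  GRing.isLinear.Build K A A _ (lmul_by a) (lmul_by_is_linear a).

Fact rmul_by_is_linear a : linear (rmul_by a).
Proof. by move=> c x y; rewrite /rmul_by bmulDl bmulZl. Qed.
HB.instance Definition _ a :=
  GRing.isLinear.Build K A A _ (rmul_by a) (rmul_by_is_linear a).

Lemma bmul0l (x : A) : 0 ** x = 0.
Proof. exact: (linear0 (rmul_by x)). Qed.
Lemma bmul0r (x : A) : x ** 0 = 0.
Proof. exact: (linear0 (lmul_by x)). Qed.

End BilinearMaps.

Lemma subspaceB (K : fieldType) (V : lmodType K) (U : subspace V) x y :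
  U x -> U y -> U (x - y).
Proof. by move=> Ux /subspaceN; apply: subspaceD. Qed.

Definition subspace_preim (K : fieldType) (V W : lmodType K) (f : {linear V -> W})
  (U : subspace W) : subspace V.
Proof.
exists (fun x => U (f x)); first by rewrite linear0; apply: subspace0.
by move=> c x y hx hy; rewrite linearP; apply: subspaceP.
Defined.

Definition subspace_null (K : fieldType) (V : lmodType K) : subspace V.
Proof.
by exists (fun x => x = 0) => [|c x y -> ->] //; rewrite scaler0 addr0.
Defined.

Section GroupAlgebra.
Variables (K : fieldType) (G : groupType).
Implicit Types (x y z : G) (a b c : {malg K[G]}).

Lemma bmulU x y : << x >> ** << y >> = << (x * y)%g >> :> {malg K[G]}.
Proof. by rewrite [LHS]malg_liftU malg_liftU. Qed.

Lemma malg_bmulA : associative (@bmul K {malg K[G]}).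
Proof.
move=> a b c.
have e1 x y (d : {malg K[G]}) : << x >> ** (<< y >> ** d) = << x >> ** << y >> ** d.
  apply: (@malg_linear_ext _ _ _ (lmul_by << x >> \o lmul_by << y >>)
    (lmul_by (<< x >> ** << y >>))) => z /=.
  by rewrite /lmul_by !bmulU mulgA.
have e2 x (b' d : {malg K[G]}) : << x >> ** (b' ** d) = << x >> ** b' ** d.
  apply: (@malg_linear_ext _ _ _ (lmul_by << x >> \o rmul_by d)
    (rmul_by d \o lmul_by << x >>)) => y; exact: e1.
apply: (@malg_linear_ext _ _ _ (rmul_by (b ** c)) (rmul_by c \o rmul_by b)) => x.
exact: e2.
Qed.

Lemma bmul1l a : << 1%g >> ** a = a.
Proof.
apply: (@malg_linear_ext _ _ _ (lmul_by << 1%g >>) idfun) => x.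
by rewrite /= /lmul_by bmulU mul1g.
Qed.

Lemma bmul1r a : a ** << 1%g >> = a.
Proof.
apply: (@malg_linear_ext _ _ _ (rmul_by << 1%g >>) idfun) => x.
by rewrite /= /rmul_by bmulU mulg1.
Qed.

Lemma augU x : aug << x >> = 1 :> K.
Proof. by rewrite /aug malg_liftU. Qed.

Lemma augB a b : aug (a - b) = aug a - aug b.
Proof. exact: (@linearB _ _ _ _ (@malg_lift K G K^o (fun=> 1))). Qed.

Lemma aug_pow0 a : aug_pow K G 0 a.
Proof. exact: ideal_gen_sub. Qed.

Lemma aug_powMS k a b :
  aug a = 0 -> aug_pow K G k b -> aug_pow K G k.+1 (a ** b).
Proof. by move=> a0 hb; apply: ideal_gen_sub; exists a, b. Qed.

Lemma aug_powUS k x b :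
  aug_pow K G k b -> aug_pow K G k.+1 ((<< x >> - << 1%g >>) ** b).
Proof. by apply: aug_powMS; rewrite augB !augU subrr. Qed.

Lemma aug_pow_leS k a : aug_pow K G k.+1 a -> aug_pow K G k a.
Proof. by apply: ideal_gen_min => _ [b [c [_ hc ->]]]; apply: idealMl. Qed.

Lemma aug_pow_le k l a : (k <= l)%N -> aug_pow K G l a -> aug_pow K G k a.
Proof.
by move=> /subnK <-; elim: (l - k)%N => [|m IH] //; rewrite addSn => /aug_pow_leS.
Qed.

Lemma malg_lift_const (V : lmodType K) (v : V) a :
  malg_lift (fun=> v) a = aug a *: v.
Proof.
rewrite /aug /malg_lift.
elim/big_rec2: _ => [|t x y _ ->]; first by rewrite scale0r.
by rewrite [RHS]scalerDl [_ *: 1]mulr1.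
Qed.

Lemma aug_lift_sum a b : aug a = 0 ->
  a ** b = malg_lift (fun x => (<< x >> - << 1%g >>) ** b) a.
Proof.
move=> a0; transitivity (malg_lift (fun x => << x >> ** b) a - aug a *: b).
  rewrite a0 scale0r subr0 -{1}[a]malg_lift_id.
  exact: (linear_malg_lift (rmul_by b)).
rewrite -malg_lift_const -scaleN1r -malg_lift_fZ -malg_lift_fD; congr malg_lift.
by apply/funext => x; rewrite scaleN1r bmulBl bmul1l.
Qed.

(** Since x (y - 1) = (x y - 1) - (x - 1), the span of the products (x - 1) b with [b] in the k-th
    power is already a two-sided ideal, hence the whole next power. *)
Lemma aug_powS_ind k (U : subspace {malg K[G]}) :
  (forall x b, aug_pow K G k b -> U ((<< x >> - << 1%g >>) ** b)) ->
  forall a, aug_pow K G k.+1 a -> U a.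
Proof.
pose gen (W : subspace {malg K[G]}) :=
  forall x b, aug_pow K G k b -> W ((<< x >> - << 1%g >>) ** b).
have J0 : forall W, gen W -> W 0 by move=> W _; apply: subspace0.
have JP k' a b : (forall W, gen W -> W a) -> (forall W, gen W -> W b) ->
    forall W, gen W -> W (k' *: a + b).
  by move=> hx hy W hW; apply: subspaceP; [apply: hx | apply: hy].
have Jl c a : (forall W, gen W -> W a) -> forall W, gen W -> W (c ** a).
  move=> ha W hW; apply: (malg_subspace_ind (U := subspace_preim (rmul_by a) W)) => x.
  apply: (ha (subspace_preim (lmul_by << x >>) W)) => y b hb /=.
  have -> : lmul_by << x >> ((<< y >> - << 1%g >>) ** b) =
      (<< (x * y)%g >> - << 1%g >>) ** b - (<< x >> - << 1%g >>) ** b.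
    rewrite /lmul_by malg_bmulA bmulBr !bmulU mulg1 -bmulBl; congr (_ ** _).
    by rewrite opprB addrA subrK.
  by apply: subspaceB; apply: hW.
have Jr c a : (forall W, gen W -> W a) -> forall W, gen W -> W (a ** c).
  move=> ha W hW; apply: (ha (subspace_preim (rmul_by c) W)) => y b hb /=.
  by rewrite /rmul_by -malg_bmulA; apply: hW; apply: Defs.idealMr.
pose J := @Ideal K {malg K[G]} (@Subspace K _
  (fun a => forall W, gen W -> W a) J0 JP) Jl Jr.
move=> hU a ha; suff : J a by apply.
move: a ha; apply: ideal_gen_min => _ [a [b [a0 hb ->]]] W hW.
rewrite (aug_lift_sum _ a0) /malg_lift.
elim/big_ind: _ => [|x y|t _]; [exact: subspace0 | exact: subspaceD |].
exact/subspaceZ/hW.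
Qed.

Lemma aug_powM p q a b :
  aug_pow K G p a -> aug_pow K G q b -> aug_pow K G (p + q) (a ** b).
Proof.
move=> ha hb; elim: p a ha => [|p IH] a; first by move=> _; apply: idealMl.
apply: (aug_powS_ind (U := subspace_preim (rmul_by b) (aug_pow K G (p.+1 + q)))).
by move=> x c hc /=; rewrite /rmul_by -malg_bmulA; apply/aug_powUS/IH.
Qed.

Lemma aug_pow_aug a : aug a = 0 -> aug_pow K G 1 a.
Proof. by move=> a0; rewrite -[a]bmul1r; apply/aug_powMS/aug_pow0. Qed.

End GroupAlgebra.

(** * Products of filtered maps *)

Section Filtered.
Variables (K : fieldType) (G H : groupType).
Implicit Types A B : G -> {malg K[H]}.

(** The logarithm needs only [r = 0]; positive [r] arises from the differences taken in the proof of
    [aug_shiftM]. *)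
Definition aug_shift (r : nat) A : Prop :=
  forall p a, aug_pow K G p a -> aug_pow K H (p + r) (malg_lift A a).

(* Discrete Leibniz rule: [AB(gx) - AB(x)] is
   [(A(gx) - A(x)) B(gx) + A(x) (B(gx) - B(x))]. *)
Lemma aug_shiftM r s A B :
  aug_shift r A -> aug_shift s B -> aug_shift (r + s) (fun x => A x ** B x).
Proof.
move=> hA hB p; elim: p r s A B hA hB => [|p IH] r s A B hA hB.
  move=> a _; rewrite add0n /malg_lift.
  elim/big_ind: _ => [|x y|x _]; [exact: subspace0 | exact: subspaceD |].
  apply: subspaceZ; apply: aug_powM.
    by have := hA 0%N << x >> (aug_pow0 _); rewrite malg_liftU.
  by have := hB 0%N << x >> (aug_pow0 _); rewrite malg_liftU.
have shL C t x : aug_shift t C -> aug_shift t (fun y => C (x * y)%g).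
  move=> hC q a ha; have -> : malg_lift (fun y => C (x * y)%g) a =
      malg_lift C (<< x >> ** a).
    rewrite -[a in RHS]malg_lift_id -[RHS]/((malg_lift C \o lmul_by << x >>) _).
    rewrite linear_malg_lift; congr malg_lift; apply/funext => y /=.
    by rewrite /lmul_by bmulU malg_liftU.
  by apply/hC/idealMl.
have shD C t x : aug_shift t C -> aug_shift t.+1 (fun y => C (x * y)%g - C y).
  move=> hC q a ha; have -> : malg_lift (fun y => C (x * y)%g - C y) a =
      malg_lift C ((<< x >> - << 1%g >>) ** a).
    rewrite -[a in RHS]malg_lift_id.
    rewrite -[RHS]/((malg_lift C \o lmul_by (<< x >> - << 1%g >>)) _).
    rewrite linear_malg_lift; congr malg_lift; apply/funext => y /=.
    by rewrite /lmul_by bmulBl !bmulU mul1g linearB /= !malg_liftU.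
  by rewrite addnS -addSn; apply/hC/aug_powUS.
apply: (aug_powS_ind (U := subspace_preim (malg_lift (fun x => A x ** B x))
  (aug_pow K H (p.+1 + (r + s))))) => x b hb.
rewrite -[subspace_preim _ _ _]/(aug_pow K H (p.+1 + (r + s))
  (malg_lift (fun x => A x ** B x) ((<< x >> - << 1%g >>) ** b))).
have -> : malg_lift (fun x => A x ** B x) ((<< x >> - << 1%g >>) ** b) =
    malg_lift (fun y => (A (x * y)%g - A y) ** B (x * y)%g) b +
    malg_lift (fun y => A y ** (B (x * y)%g - B y)) b.
  rewrite -[b in LHS]malg_lift_id -malg_lift_fD.
  rewrite -[LHS]/((malg_lift _ \o lmul_by (<< x >> - << 1%g >>)) _).
  rewrite linear_malg_lift; congr malg_lift; apply/funext => y /=.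
  rewrite /lmul_by bmulBl !bmulU mul1g linearB /= !malg_liftU.
  by rewrite bmulBl bmulBr addrA subrK.
(* [b] lies one power lower, but each summand has a differenced factor, whose shift is one
   higher. *)
apply: subspaceD.
  by rewrite addSnnS -addSn; apply: (IH r.+1 s) => //; [exact: shD | exact: shL].
by rewrite addSnnS -addnS; apply: (IH r s.+1) => //; exact: shD.
Qed.

End Filtered.

(** The power map is not a homomorphism, so [malg_map_aug_pow] does not apply. It is instead a
    pointwise product of the identity and the preceding power, both of shift 0. *)
Lemma aug_shift_exp (K : fieldType) (G : groupType) n :
  aug_shift 0 (fun x : G => << (x ^+ n)%g >> : {malg K[G]}).
Proof.
elim: n => [|n IH].
  move=> p a; rewrite addn0; case: p => [|p ha]; first by move=> _; apply: aug_pow0.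
  suff -> : malg_lift (fun x : G => << (x ^+ 0)%g >>) a = 0 :> {malg K[G]}.
    exact: subspace0.
  move: a ha; pose U := subspace_preim (malg_lift (fun x : G => << (x ^+ 0)%g >>))
    (subspace_null {malg K[G]}).
  apply: (aug_powS_ind (U := U)) => x b _ /=.
  rewrite -[b]malg_lift_id -[LHS]/((malg_lift _ \o lmul_by (<< x >> - << 1%g >>)) _).
  rewrite linear_malg_lift /malg_lift big1 // => y _ /=.
  by rewrite /lmul_by bmulBl !bmulU linearB /= !malg_liftU !expg0 subrr scaler0.
have -> : (fun x : G => << (x ^+ n.+1)%g >> : {malg K[G]}) =
    (fun x => << x >> ** << (x ^+ n)%g >>).
  by apply/funext => x; rewrite bmulU expgS.
apply: (@aug_shiftM _ _ _ 0 0) => // p a ha.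
by rewrite addn0 malg_lift_id.
Qed.

(** * Logarithms of group elements *)

(* Stated for an abstract algebra [A] with a map [e : G -> A] in order to keep
   unification from unfolding the product of [{malg rat[G]}]. *)
Section TruncatedLog.
Variables (G : groupType) (A : naAlgType rat) (e : G -> A) (I : nat -> ideal A).
Implicit Types (x y z g h : G) (a b c : A).

Hypothesis bmulA : associative (@bmul rat A).
Hypothesis eM : forall x y, e (x * y)%g = e x ** e y.
Hypothesis e1l : forall a, e 1%g ** a = a.
Hypothesis e1r : forall a, a ** e 1%g = a.
Hypothesis I0 : forall a, I 0%N a.
Hypothesis Il : forall k x b, I k b -> I k.+1 ((e x - e 1%g) ** b).
Hypothesis Ir : forall k x b, I k b -> I k.+1 (b ** (e x - e 1%g)).
Hypothesis I_le : forall k l a, (k <= l)%N -> I l a -> I k a.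

Let ul x : A -> A := lmul_by (e x - e 1%g).
Let ur z : A -> A := rmul_by (e z - e 1%g).

Lemma iter_fdiff_expl i x b n :
  iter i (@fdiff _) (fun n => e (x ^+ n)%g ** b) n =
  e (x ^+ n)%g ** iter i (ul x) b.
Proof.
elim: i n => [|i IH] n //.
rewrite iter_fdiffSr !IH iterS [in RHS]/ul /lmul_by -bmulBl bmulA.
by rewrite bmulBr -!eM mulg1 expgSr.
Qed.

Lemma iter_fdiff_expr i z b n :
  iter i (@fdiff _) (fun n => b ** e (z ^+ n)%g) n =
  iter i (ur z) b ** e (z ^+ n)%g.
Proof.
elim: i n => [|i IH] n //.
rewrite iter_fdiffSr !IH iterS [in RHS]/ur /rmul_by -bmulBr -bmulA.
by rewrite bmulBl -!eM mul1g expgS.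
Qed.

Lemma expl_newton x b n N : (n < N)%N ->
  e (x ^+ n)%g ** b = \sum_(i < N) 'C(n, i)%:R *: iter i (ul x) b.
Proof.
move=> h; rewrite (newton (fun n => e (x ^+ n)%g ** b) h).
by apply: eq_bigr => i _; rewrite iter_fdiff_expl expg0 e1l.
Qed.

Lemma expr_newton z b n N : (n < N)%N ->
  b ** e (z ^+ n)%g = \sum_(i < N) 'C(n, i)%:R *: iter i (ur z) b.
Proof.
move=> h; rewrite (newton (fun n => b ** e (z ^+ n)%g) h).
by apply: eq_bigr => i _; rewrite iter_fdiff_expr expg0 e1r.
Qed.

Lemma iter_ul_mem i x k b : I k b -> I (k + i)%N (iter i (ul x) b).
Proof.
by move=> hb; elim: i => [|i IH]; rewrite ?addn0 // addnS iterS; apply: Il.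
Qed.

Lemma iter_ur_mem i x k b : I k b -> I (k + i)%N (iter i (ur x) b).
Proof.
by move=> hb; elim: i => [|i IH]; rewrite ?addn0 // addnS iterS; apply: Ir.
Qed.

(** In the expansion of x^m b z^n the coefficient of C(m,i) C(n,j) is (x - 1)^i b (z - 1)^j. It lies
    in [I (i + j)], so [F] kills it when [i + j >= d] and the Leibniz rule [deriv_at0_diag]
    applies. *)
Lemma deriv_at0_exp_exp d (V : lmodType rat) (F : {linear A -> V}) x z b :
  (forall a, I d a -> F a = 0) ->
  deriv_at0 d (fun n => F (e (x ^+ n)%g ** b ** e (z ^+ n)%g)) =
  deriv_at0 d (fun n => F (e (x ^+ n)%g ** b)) +
  deriv_at0 d (fun n => F (b ** e (z ^+ n)%g)).
Proof.
move=> F0; pose W i j := F (iter i (ul x) (iter j (ur z) b)).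
pose S m n := F (e (x ^+ m)%g ** b ** e (z ^+ n)%g).
transitivity (deriv_at0 d (fun n => S n 0%N) + deriv_at0 d (fun n => S 0%N n)).
  2: congr (_ + _); apply: eq_deriv_at0 => n; rewrite /S expg0.
  2: by rewrite [_ ** e 1%g]e1r.
  2: by rewrite [e 1%g ** _]e1l.
apply: (@deriv_at0_diag _ d S W).
- move=> i j hij; apply: F0; apply: (I_le hij); rewrite addnC.
  by apply: iter_ul_mem; rewrite -[j in I j]add0n; apply: iter_ur_mem.
move=> m n N hm hn; rewrite /S -bmulA (expr_newton _ _ hn).
rewrite -[_ ** _]/(lmul_by (e (x ^+ m)%g) _) linear_sum linear_sum exchange_big.
apply: eq_bigr => j _ /=; rewrite linearZ linearZ /= /lmul_by (expl_newton _ _ hm).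
rewrite linear_sum scaler_sumr; apply: eq_bigr => i _.
by rewrite linearZ scalerA natrM mulrC.
Qed.

(** The logarithm series truncated below degree [d]: the i-th difference of n |-> x^n at 0 is (x -
    1)^i. *)
Definition unip_log d x : A := deriv_at0 d (fun n => e (x ^+ n)%g).

Lemma unip_logS d x :
  I d (unip_log d.+1 x - unip_log d x).
Proof.
rewrite /unip_log /deriv_at0 big_ord_recr /= addrAC subrr add0r; apply: subspaceZ.
have -> : (fun n => e (x ^+ n)%g) =
    (fun n => e (x ^+ n)%g ** e 1%g) :> (nat -> A).
  by apply/funext => n; rewrite e1r.
rewrite iter_fdiff_expl expg0 e1l -[d in I d]add0n.
exact: iter_ul_mem.
Qed.

(** [x] and [z] need not commute: their commutators enter x^n z^n only at second order in n. *)
Lemma deriv_at0_expM d (V : lmodType rat) (F : {linear A -> V}) x z :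
  (forall a, I d a -> F a = 0) ->
  deriv_at0 d (fun n => F (e (x ^+ n * z ^+ n)%g)) =
  F (unip_log d x) + F (unip_log d z).
Proof.
move=> F0; rewrite /unip_log -!deriv_at0_linear.
transitivity (deriv_at0 d (fun n => F (e (x ^+ n)%g ** e 1%g ** e (z ^+ n)%g))).
  by apply: eq_deriv_at0 => n; rewrite e1r eM.
by rewrite deriv_at0_exp_exp //; congr (_ + _); apply: eq_deriv_at0 => n; rewrite ?e1r ?e1l.
Qed.

Lemma unip_logV d (V : lmodType rat) (F : {linear A -> V}) h :
  (forall a, I d a -> F a = 0) ->
  F (unip_log d h^-1%g) = - F (unip_log d h).
Proof.
move=> F0; apply/eqP; rewrite -addr_eq0 addrC -deriv_at0_expM //; apply/eqP.
rewrite -[RHS](deriv_at0_const d (F (e 1%g))).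
by apply: eq_deriv_at0 => n; rewrite expVgn mulgV.
Qed.

Lemma unip_logX d (V : lmodType rat) (F : {linear A -> V}) g m :
  (forall a, I d a -> F a = 0) ->
  F (unip_log d (g ^+ m)%g) = m%:R *: F (unip_log d g).
Proof.
move=> F0; elim: m => [|m IH].
  rewrite expg0 scale0r /unip_log -deriv_at0_linear.
  rewrite -[RHS](deriv_at0_const d (F (e 1%g))).
  by apply: eq_deriv_at0 => n; rewrite /= expg1n.
rewrite -natr1 scalerDl scale1r -IH addrC -deriv_at0_expM //.
rewrite /unip_log -deriv_at0_linear; apply: eq_deriv_at0 => n.
by rewrite /= expgS expgMn //; apply: commuteX.
Qed.

Lemma unip_logJ d g h :
  unip_log d (h * g * h^-1)%g = e h ** unip_log d g ** e h^-1%g.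
Proof.
rewrite -[RHS]/((rmul_by (e h^-1%g) \o lmul_by (e h)) _) -deriv_at0_linear.
apply: eq_deriv_at0 => n /=; rewrite /rmul_by /lmul_by -!eM; congr e.
by elim: n => [|n IH]; rewrite ?expg0 ?mulg1 ?mulgV // !expgS IH !mulgA mulgVK.
Qed.

(** The differential of the conjugation action is ad(log h): the left factor h^n and the right
    factor h^-n contribute one term each. *)
Lemma deriv_at0_conj d (V : lmodType rat) (F : {linear A -> V}) h g :
  (forall a, I d a -> F a = 0) ->
  deriv_at0 d (fun n => F (unip_log d (h ^+ n * g * h ^- n)%g)) =
  F (unip_log d h ** unip_log d g) - F (unip_log d g ** unip_log d h).
Proof.
move=> F0; set b := unip_log d g.
transitivity (deriv_at0 d (fun n =>
    F (e (h ^+ n)%g ** b ** e (h^-1 ^+ n)%g))).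
  by apply: eq_deriv_at0 => n; rewrite unip_logJ expVgn.
rewrite deriv_at0_exp_exp //.
have -> : deriv_at0 d (fun n => F (e (h ^+ n)%g ** b)) = F (unip_log d h ** b).
  rewrite -[RHS]/((F \o rmul_by b) _) -deriv_at0_linear; exact: eq_deriv_at0.
congr (_ + _).
rewrite -[RHS]/(- (F \o lmul_by b) (unip_log d h)) -unip_logV.
  rewrite -deriv_at0_linear; exact: eq_deriv_at0.
by move=> a ha; apply: F0; apply: idealMl.
Qed.

(** Taking differences applies [ad], conjugation by [h] minus the identity. As [ad a] is [h - 1, a]
    h^-1, it raises the filtration by one. *)
Lemma iter_fdiff_conj i g h m :
  I i (iter i (@fdiff A) (fun m => e (h ^+ m * g * h ^- m)%g) m).
Proof.
pose ad a := e h ** a ** e h^-1%g - a.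
have -> : iter i (@fdiff A) (fun m => e (h ^+ m * g * h ^- m)%g) m =
    e (h ^+ m)%g ** iter i ad (e g) ** e (h ^- m)%g.
  elim: i m => [|i IH] m; first by rewrite /= !eM.
  rewrite iter_fdiffSr !IH iterS; set a := iter i ad _.
  rewrite /ad bmulBr bmulBl; congr (_ - _).
  rewrite !bmulA -eM -[RHS]bmulA -eM.
  by rewrite -expgSr -invgM -expgSr.
apply: Defs.idealMr; apply: idealMl; elim: i => [|i IH]; first exact: I0.
rewrite iterS; set a := iter i ad _ in IH *.
have -> : ad a = ((e h - e 1%g) ** a - a ** (e h - e 1%g)) ** e h^-1%g.
  rewrite (bmulBl (e h)) (bmulBr a) e1l e1r opprB addrA subrK bmulBl.
  by rewrite -(bmulA a) -eM mulgV e1r.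
by apply: Defs.idealMr; apply: subspaceB; [apply: Il | apply: Ir].
Qed.

End TruncatedLog.

(** * Logarithms in the completed group algebra *)

Section CompletionComponent.
Variables (K : fieldType) (A : naAlgType K) (F : nat -> ideal A).

Definition cmpl_comp k (x : completion F) : quotspace (F k) := x k.

Fact cmpl_comp_is_linear k : linear (cmpl_comp k).
Proof. by []. Qed.
HB.instance Definition _ k := GRing.isLinear.Build K (completion F) (quotspace (F k)) _
  (cmpl_comp k) (cmpl_comp_is_linear k).

End CompletionComponent.

Section GroupLog.
Variable G : groupType.
Implicit Types (x y z g h : G) (a b c : {malg rat[G]}).

Definition gelt x : {malg rat[G]} := << x >>.

Definition glog d x : {malg rat[G]} := unip_log gelt d x.

Let eM x y : gelt (x * y)%g = gelt x ** gelt y.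
Proof. by rewrite [RHS]bmulU. Qed.
Let e1l a : gelt 1%g ** a = a. Proof. exact: bmul1l. Qed.
Let e1r a : a ** gelt 1%g = a. Proof. exact: bmul1r. Qed.
Let I0 a : aug_pow rat G 0 a. Proof. exact: aug_pow0. Qed.
Let Il k x b : aug_pow rat G k b -> aug_pow rat G k.+1 ((gelt x - gelt 1%g) ** b).
Proof. exact: aug_powUS. Qed.
Let Ir k x b : aug_pow rat G k b -> aug_pow rat G k.+1 (b ** (gelt x - gelt 1%g)).
Proof.
move=> hb; rewrite -addn1; apply: aug_powM => //; apply: aug_pow_aug.
by rewrite augB !augU subrr.
Qed.
Let I_le k l a : (k <= l)%N -> aug_pow rat G l a -> aug_pow rat G k a.
Proof. exact: aug_pow_le. Qed.

Lemma glogS d x : aug_pow rat G d (glog d.+1 x - glog d x).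
Proof. exact: (unip_logS (@malg_bmulA rat G) eM e1l e1r I0 Il). Qed.

Lemma deriv_at0_gelt_mul d (V : lmodType rat) (F : {linear {malg rat[G]} -> V}) x z :
  (forall a, aug_pow rat G d a -> F a = 0) ->
  deriv_at0 d (fun n => F (gelt ((x ^+ n) * (z ^+ n))%g)) =
  F (glog d x) + F (glog d z).
Proof. exact: (deriv_at0_expM (@malg_bmulA rat G) eM e1l e1r I0 Il Ir I_le). Qed.

Lemma glogX d (V : lmodType rat) (F : {linear {malg rat[G]} -> V}) g m :
  (forall a, aug_pow rat G d a -> F a = 0) ->
  F (glog d (g ^+ m)%g) = m%:R *: F (glog d g).
Proof. exact: (unip_logX (@malg_bmulA rat G) eM e1l e1r I0 Il Ir I_le). Qed.

Lemma glog_conj d (V : lmodType rat) (F : {linear {malg rat[G]} -> V}) h g :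
  (forall a, aug_pow rat G d a -> F a = 0) ->
  deriv_at0 d (fun n => F (glog d (h ^+ n * g * h ^- n)%g)) =
  F (glog d h ** glog d g) - F (glog d g ** glog d h).
Proof. exact: (deriv_at0_conj (@malg_bmulA rat G) eM e1l e1r I0 Il Ir I_le). Qed.

Lemma iter_fdiff_gelt_conj i g h m : aug_pow rat G i
  (iter i (@fdiff _) (fun m => gelt (h ^+ m * g * h ^- m)%g) m).
Proof. exact: (iter_fdiff_conj (@malg_bmulA rat G) eM e1l e1r I0 Il Ir). Qed.

(** [glog d] is a fixed rational combination of power maps, and these preserve the filtration. *)
Lemma glog_aug_shift d : aug_shift 0 (glog d).
Proof.
have hB (A B : G -> {malg rat[G]}) : aug_shift 0 A -> aug_shift 0 B ->
    aug_shift 0 (fun x => A x - B x).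
  move=> hA hB p a ha.
  have -> : malg_lift (fun x => A x - B x) a = malg_lift A a - malg_lift B a.
    rewrite -[in RHS]scaleN1r -malg_lift_fZ -malg_lift_fD; congr malg_lift.
    by apply/funext => x; rewrite scaleN1r.
  by apply: subspaceB; [apply: hA | apply: hB].
pose D i n x := iter i (@fdiff {malg rat[G]}) (fun n => gelt (x ^+ n)%g) n.
have hi i n : aug_shift 0 (D i n).
  elim: i n => [|i IH] n; first exact: aug_shift_exp.
  exact: (hB (D i n.+1) (D i n)).
move=> p a ha; have -> : malg_lift (glog d) a =
    \sum_(i < d) log_coef i *: malg_lift (D i 0%N) a.
  rewrite /malg_lift; under [RHS]eq_bigr do rewrite scaler_sumr.
  rewrite exchange_big; apply: eq_bigr => x _ /=; rewrite scaler_sumr.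
  by apply: eq_bigr => i _; rewrite !scalerA mulrC.
elim/big_ind: _ => [|u v|i _]; [exact: subspace0 | exact: subspaceD |].
by apply: subspaceZ; apply: hi.
Qed.

Lemma qproj_aug0 d a : aug_pow rat G d a -> qproj (aug_pow rat G d) a = 0.
Proof. by move=> ha; rewrite -(linear0 (qproj _)); apply/qprojP; rewrite subr0. Qed.

Fact clog_compat x k : exists a,
  qproj (aug_pow rat G k.+1) (glog k.+1 x) = qproj (aug_pow rat G k.+1) a /\
  qproj (aug_pow rat G k) (glog k x) = qproj (aug_pow rat G k) a.
Proof.
exists (glog k.+1 x); split=> //; apply/esym/qprojP; exact: glogS.
Qed.

Definition clog x : cgalg rat G := Completion (clog_compat x).

Lemma clogX g m : clog (g ^+ m)%g = m%:R *: clog g.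
Proof.
apply/cmpl_eqP => k.
exact: (@glogX k _ (qproj (aug_pow rat G k)) g m (@qproj_aug0 k)).
Qed.

Lemma clog_conj d g h : cmpl_filt d
  (deriv_at0 d (fun n => clog (h ^+ n * g * h ^- n)%g)
   - (clog h ** clog g - clog g ** clog h)).
Proof.
set D := deriv_at0 d _; set B := clog h ** _ - _.
suff e : cmpl_comp d D = cmpl_comp d B.
  by rewrite -[cmpl_filt _ _]/(cmpl_comp d (D - B) = 0) linearB /= e subrr.
rewrite -(deriv_at0_linear (cmpl_comp d)).
rewrite [LHS](@glog_conj d _ (qproj (aug_pow rat G d)) h g (@qproj_aug0 d)).
have qM a b := esym (qmulE (aug_pow rat G d) a b).
exact: (f_equal2 (fun u v => u - v) (qM (glog d h) (glog d g)) (qM (glog d g) (glog d h))).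
Qed.

(** This is what will make the coordinates of the logarithm polynomial functions on the group. *)
Lemma clog_lift d a : aug_pow rat G d a -> cmpl_filt d (malg_lift clog a).
Proof.
move=> ha; rewrite /cmpl_filt /= -[LHS]/(cmpl_comp d (malg_lift clog a)).
rewrite linear_malg_lift -(linear_malg_lift (qproj (aug_pow rat G d)) (glog d)).
by apply: qproj_aug0; rewrite -[d in aug_pow _ _ d]addn0; apply: glog_aug_shift.
Qed.

End GroupLog.

Section GroupMorphisms.
Variables (G H : groupType) (f : {multiplicative G -> H}).
Local Open Scope group_scope.

Lemma gmorph1 : f 1 = 1.
Proof. by apply: (@mulgI _ (f 1)); rewrite -gmulfM !mulg1. Qed.

Lemma gmorphV x : f x^-1 = (f x)^-1.
Proof. by apply: (@mulgI _ (f x)); rewrite -gmulfM !mulgV gmorph1. Qed.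

Lemma gmorphX n x : f (x ^+ n) = f x ^+ n.
Proof. by elim: n => [|n IH]; rewrite ?expg0 ?gmorph1 // !expgS gmulfM IH. Qed.

End GroupMorphisms.

Lemma glog_map (G H : groupType) (f : {multiplicative G -> H}) d g :
  malg_map f (glog d g) = glog d (f g).
Proof.
rewrite /glog /unip_log -deriv_at0_linear; apply: eq_deriv_at0 => n /=.
rewrite /gelt -(gmorphX f n g); exact: malg_liftU.
Qed.

Lemma cgalg_map_clog (G H : groupType) (f : {multiplicative G -> H}) g k :
  cgalg_map f (clog g) k = qproj (aug_pow rat H k) (glog k (f g)).
Proof.
rewrite -glog_map.
exact: (quot_mapE (f := @malg_map rat G H f) (glog k g) (@malg_map_aug_pow rat G H f k)).
Qed.

(** Differentiate (g, g)^n = (g, 1)^n (1, g)^n at n = 0. *)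
Lemma clog_malcev (G : groupType) (g : G) : malcev (clog g).
Proof.
apply/cmpl_eqP => k.
have eL := cgalg_map_clog (@left_hom G) g k.
have eR := cgalg_map_clog (@right_hom G) g k.
apply: (etrans (cgalg_map_clog (@diag_hom G) g k)).
apply: (etrans _ (f_equal2 +%R (esym eL) (esym eR))).
apply: (etrans _ (deriv_at0_gelt_mul (left_hom g) (right_hom g)
  (@qproj_aug0 (G * G)%type k))).
rewrite /glog /unip_log -deriv_at0_linear; apply: eq_deriv_at0 => n /=.
rewrite -!gmorphX; congr (qproj _ (gelt _)).
by rewrite -[RHS]/(pg_mul _ _) /pg_mul /= mulg1 mul1g.
Qed.

(** * Additivity of homogeneous polynomial class functions *)

Section PolynomialClassFunction.
Variables (G : groupType) (V : lmodType rat) (M : G -> Prop) (f : G -> V) (d : nat).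
Implicit Types x y z u v w : G.
Local Open Scope group_scope.

Hypothesis MM : forall x y, M x -> M y -> M (x * y).
Hypothesis MV : forall x, M x -> M x^-1.
Hypothesis fX : forall x n, M x -> f (x ^+ n) = n%:R *: f x.
Hypothesis fJ : forall x y, M x -> M y -> f (y * x * y^-1) = f x.
Hypothesis d_gt1 : (1 < d)%N.
Hypothesis f_aug : forall a, aug_pow rat G d a -> malg_lift f a = 0%R.

(** Only the commutators themselves, not the subgroups they generate: words are reordered one
    commutator at a time. *)
Fixpoint iter_comm (i : nat) (z : G) : Prop :=
  if i is i'.+1 then exists u v, [/\ M u, iter_comm i' v & z = u * v * u^-1 * v^-1]
  else M z.

Lemma iter_comm_mem i z : iter_comm i z -> M z.
Proof.
elim: i z => [|i IH] z //= [u [v [Mu /IH Mv ->]]].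
by apply: MM; [apply: MM; [apply: MM|apply: MV] | apply: MV].
Qed.

(** As u v u^-1 v^-1 - 1 = [u - 1, v - 1] u^-1 v^-1, each bracket gains one power of the ideal. *)
Lemma iter_comm_aug i z : iter_comm i z -> aug_pow rat G i.+1 (gelt z - gelt 1)%R.
Proof.
elim: i z => [|i IH] z.
  by move=> _; rewrite -[(_ - _)%R]bmul1r; apply/aug_powUS/aug_pow0.
move=> [u [v [Mu /IH hv ->]]].
have -> : (gelt (u * v * u^-1 * v^-1) - gelt 1)%R =
    (((gelt u - gelt 1) ** (gelt v - gelt 1)
     - (gelt v - gelt 1) ** (gelt u - gelt 1)) ** gelt (u^-1 * v^-1))%R.
  have eM x y : gelt x ** gelt y = gelt (x * y) by exact: bmulU.
  have zE (W : zmodType) (a b c e s : W) :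
      (a - b - (c - s) - (e - c - (b - s)) = a - e)%R.
    rewrite -(addrA a) -opprD -(addrA e) -opprD (addrCA c) opprB [LHS]addrA subrK.
    by [].
  have -> : ((gelt u - gelt 1) ** (gelt v - gelt 1)
      - (gelt v - gelt 1) ** (gelt u - gelt 1) = gelt (u * v) - gelt (v * u))%R.
    by rewrite !bmulBl !bmulBr !eM !mul1g !mulg1 zE.
  by rewrite bmulBl !eM !mulgA mulgK mulgV.
apply: Defs.idealMr; apply: subspaceB; first exact: aug_powUS.
by rewrite -addn1; apply: aug_powM => //; apply: aug_pow_aug; rewrite augB !augU subrr.
Qed.

Let negligible z := forall x, M x -> f (x * z) = f x.

Lemma fC x y : M x -> M y -> f (x * y) = f (y * x).
Proof. by move=> Mx My; rewrite -(fJ (MM Mx My) My) !mulgA mulgK. Qed.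

Lemma negligible_insert w x y : M w -> negligible w -> M x -> M y ->
  f (x * w * y) = f (x * y).
Proof.
move=> Mw hw Mx My; rewrite fC //; last exact: MM.
by rewrite mulgA hw ?(fC My Mx) //; apply: MM.
Qed.

Lemma mem_expg x n : M x -> M 1 -> M (x ^+ n).
Proof. by move=> Mx M1; elim: n => [|n IH]; rewrite ?expg0 // expgS; apply: MM. Qed.

(** Moving [z] past another element costs a commutator that [f] does not see, so [f] agrees on (x
    z)^n and x^n z^n. At n = 0 the first has derivative f(x z) by homogeneity, the second f(x) +
    f(z) by [deriv_at0_gelt_mul]. *)
Lemma f_mul_of_negligible i : (forall z, iter_comm i.+1 z -> negligible z) ->
  forall z x, iter_comm i z -> M x -> f (x * z) = (f x + f z)%R.
Proof.
move=> hneg z x hz Mx; have Mz := iter_comm_mem hz.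
have M1 : M 1 by rewrite -(mulgV x); apply: MM => //; apply: MV.
have swap a b y : M a -> M b -> M y -> f (a * (y * z) * b) = f (a * (z * y) * b).
  move=> Ma Mb My; set w := y * z * y^-1 * z^-1.
  have hw : iter_comm i.+1 w by exists y, z.
  have -> : a * (y * z) * b = a * w * (z * y * b) by rewrite /w !mulgA !mulgVK.
  rewrite (negligible_insert (iter_comm_mem hw) (hneg _ hw)) ?mulgA //.
  by apply: MM => //; apply: MM.
(* The prefix [y] makes the induction work: it absorbs the factor [x * z] that is split off. *)
have fXZ n y : M y -> f (y * (x * z) ^+ n) = f (y * (x ^+ n * z ^+ n)).
  elim: n y => [|n IH] y My; first by rewrite !expg0 !mulg1.
  have Mxn := mem_expg n Mx M1; have Mzn := mem_expg n Mz M1.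
  rewrite expgS mulgA IH; last by apply: MM => //; apply: MM.
  have -> : y * (x * z) * (x ^+ n * z ^+ n) = (y * x) * (z * x ^+ n) * z ^+ n.
    by rewrite !mulgA.
  rewrite -swap //; last exact: MM.
  by rewrite expgS (expgS z) !mulgA.
pose F : {linear {malg rat[G]} -> V} := @malg_lift rat G V f.
have FE y : F (gelt y) = f y by apply: malg_liftU.
have dE y : M y -> F (glog d y) = f y.
  move=> My; rewrite /glog /unip_log -deriv_at0_linear.
  rewrite -[RHS](deriv_at0_id (f y) d_gt1); apply: eq_deriv_at0 => n.
  by rewrite -fX // -FE.
rewrite -(dE x) // -(dE z) // -(deriv_at0_gelt_mul (F := F)) //.
rewrite -[LHS](deriv_at0_id _ d_gt1); apply: eq_deriv_at0 => n.
rewrite -fX; last exact: MM.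
by rewrite -[_ ^+ n]mul1g fXZ // mul1g -FE.
Qed.

(** Descending induction on [i]: for [i >= d] the element z - 1 lies in the d-th power, which [f]
    kills. Below that, z = [u, v] gives z v = u v u^-1, so f(z v) = f(v) for a class function, while
    f(z v) = f(z) + f(v) by [f_mul_of_negligible]; hence f(z) = 0. *)
Lemma iter_comm_negligible i z : (0 < i)%N -> iter_comm i z -> negligible z.
Proof.
elim: {i}(d - i)%N {-2}i (erefl (d - i)%N) z => [|k IH] i e z i0 hz x Mx.
  pose F : {linear {malg rat[G]} -> V} := @malg_lift rat G V f.
  have FE y : F (gelt y) = f y by apply: malg_liftU.
  apply/eqP; rewrite -subr_eq0 -!FE -linearB; apply/eqP/f_aug.
  have -> : (gelt (x * z) - gelt x)%R = (gelt x ** (gelt z - gelt 1))%R.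
    rewrite bmulBr; congr (_ - _)%R; apply/esym; [exact: bmulU | exact: bmul1r].
  apply: (@aug_pow_le _ _ _ i.+1); first by lia.
  exact/idealMl/iter_comm_aug.
have hneg z' : iter_comm i.+1 z' -> negligible z' by apply: IH; lia.
have mulE := f_mul_of_negligible hneg.
case: i e i0 hz hneg mulE => // i e _ hz hneg mulE.
have [u [v [Mu hv ez]]] := hz; have Mv := iter_comm_mem hv.
have Mz := iter_comm_mem hz.
suff f0 : f z = 0%R by rewrite mulE // f0 addr0.
have := mulE z v hz Mv; rewrite fC // ez mulgVK fJ // => /(congr1 (fun t => t - f v)%R).
by rewrite subrr addrAC subrr add0r -ez => <-.
Qed.

Lemma polynomial_class_functionM x y : M x -> M y -> f (x * y) = (f x + f y)%R.
Proof.
move=> Mx My; apply: (@f_mul_of_negligible 0) => // z.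
exact: iter_comm_negligible.
Qed.

End PolynomialClassFunction.

(** * The target of the holonomy Lie algebra *)

Section QuotientLift.
Variables (K : fieldType) (V W : lmodType K) (U : subspace V) (f : {linear V -> W}).

Definition qlift of (forall u, U u -> f u = 0) : quotspace U -> W :=
  fun x => f (repr x).

Hypothesis fU : forall u, U u -> f u = 0.

Lemma qliftE x : qlift fU (qproj U x) = f x.
Proof.
apply/eqP; rewrite -subr_eq0 -linearB; apply/eqP/fU/qprojP; exact: qproj_repr.
Qed.

Fact qlift_is_linear : linear (qlift fU).
Proof.
move=> c x y; have [a ->] := qproj_surj x; have [b ->] := qproj_surj y.
by rewrite -linearP !qliftE linearP.
Qed.
HB.instance Definition _ := GRing.isLinear.Build K (quotspace U) W _ (qlift fU)
  qlift_is_linear.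

End QuotientLift.

Lemma qliftM (K : fieldType) (A B : naAlgType K) (I : ideal A) (f : {linear A -> B})
    (fI : forall u, I u -> f u = 0) :
  {morph f : x y / x ** y} -> {morph qlift fI : x y / x ** y}.
Proof.
move=> fM x y; have [a ->] := qproj_surj x; have [b ->] := qproj_surj y.
by rewrite [_ ** _ in LHS]qmulE !qliftE.
Qed.

Definition ideal_null (K : fieldType) (A : naAlgType K) : ideal A.
Proof.
by exists (subspace_null A) => a x /= ->; rewrite ?bmul0r ?bmul0l.
Defined.

(* The semidirect product of the line spanned by [x] with the abelian Lie algebra
   [V[x]]: the pair [(s, v)] stands for [s x + \sum_j v_j x^j], and [x] acts by
   multiplication. *)
Definition aff (V : lmodType rat) : Type := (rat^o * (nat -> V))%type.

Section Affine.
Variable V : lmodType rat.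

HB.instance Definition _ := GRing.Lmodule.on (aff V).

Definition aff_mul (u v : aff V) : aff V :=
  (0, fun j => if j is i.+1 then u.1 *: v.2 i - v.1 *: u.2 i else 0).

Lemma aff_eqP (u v : aff V) : u.1 = v.1 -> (forall j, u.2 j = v.2 j) -> u = v.
Proof. by case: u v => [a b] [c d] /= -> h; congr pair; apply/funext. Qed.

Fact aff_mulDl : left_distributive aff_mul +%R.
Proof.
move=> u v w; apply: aff_eqP => [|[|j]]; try exact/esym/addr0.
rewrite -[LHS]/((u.1 + v.1) *: w.2 j - w.1 *: (u.2 j + v.2 j)).
by rewrite scalerDl scalerDr opprD addrACA.
Qed.
Fact aff_mulDr : right_distributive aff_mul +%R.
Proof.
move=> u v w; apply: aff_eqP => [|[|j]]; try exact/esym/addr0.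
rewrite -[LHS]/(u.1 *: (v.2 j + w.2 j) - (v.1 + w.1) *: u.2 j).
by rewrite scalerDl scalerDr opprD addrACA.
Qed.
Fact aff_mulZl c u v : aff_mul (c *: u) v = c *: aff_mul u v.
Proof.
apply: aff_eqP => [|[|j]]; try exact/esym/scaler0.
rewrite -[LHS]/((c * u.1) *: v.2 j - v.1 *: (c *: u.2 j)).
by rewrite [RHS]scalerBr !scalerA [v.1 * c]mulrC.
Qed.
Fact aff_mulZr c u v : aff_mul u (c *: v) = c *: aff_mul u v.
Proof.
apply: aff_eqP => [|[|j]]; try exact/esym/scaler0.
rewrite -[LHS]/(u.1 *: (c *: v.2 j) - (c * v.1) *: u.2 j).
by rewrite [RHS]scalerBr !scalerA [u.1 * c]mulrC.
Qed.
HB.instance Definition _ := hasBilinearMul.Build rat (aff V)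
  aff_mulDl aff_mulDr aff_mulZl aff_mulZr.

Lemma aff_mul1 (u v : aff V) : (u ** v).1 = 0. Proof. by []. Qed.
Lemma aff_mul2_0 (u v : aff V) : (u ** v).2 0%N = 0. Proof. by []. Qed.
Lemma aff_mul2_S (u v : aff V) j :
  (u ** v).2 j.+1 = u.1 *: v.2 j - v.1 *: u.2 j.
Proof. by []. Qed.

Lemma aff_alt (u : aff V) : u ** u = 0.
Proof. by apply: aff_eqP => // -[|j] //; rewrite aff_mul2_S subrr. Qed.

Lemma aff_jacobi (u v w : aff V) : u ** (v ** w) + v ** (w ** u) + w ** (u ** v) = 0.
Proof.
have E (x y z : aff V) j : (x + y + z).2 j = x.2 j + y.2 j + z.2 j by [].
apply: aff_eqP => [|[|[|j]]]; rewrite ?E.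
- by rewrite /= !addr0.
- by rewrite !aff_mul2_0 !addr0.
- by rewrite !aff_mul2_S !aff_mul2_0 !aff_mul1 !scaler0 !scale0r subrr !addr0.
rewrite !aff_mul2_S !aff_mul1 !scale0r !subr0 !scalerBr !scalerA.
rewrite [v.1 * u.1]mulrC [w.1 * u.1]mulrC [w.1 * v.1]mulrC.
set a := (_ * _) *: w.2 j; set b := (_ * _) *: v.2 j; set c := (_ * _) *: u.2 j.
by rewrite (addrC (a - b)) !subrKA subrr.
Qed.

Definition aff_fst (u : aff V) : rat^o := u.1.
Fact aff_fst_is_linear : linear aff_fst. Proof. by []. Qed.
HB.instance Definition _ := GRing.isLinear.Build rat (aff V) rat^o _ aff_fst
  aff_fst_is_linear.

Definition aff_coef j (u : aff V) : V := u.2 j.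
Fact aff_coef_is_linear j : linear (aff_coef j). Proof. by []. Qed.
HB.instance Definition _ j := GRing.isLinear.Build rat (aff V) V _ (aff_coef j)
  (aff_coef_is_linear j).

(* The degree filtration: [x] and [V] have degree [1]. *)
Definition aff_filt_set k (u : aff V) : Prop := u.1 = 0 /\ forall j, (j.+1 < k)%N -> u.2 j = 0.

Fact aff_filt0 k : aff_filt_set k 0. Proof. by []. Qed.
Fact aff_filtP k c u v :
  aff_filt_set k u -> aff_filt_set k v -> aff_filt_set k (c *: u + v).
Proof.
move=> [u0 uj] [v0 vj]; split=> [|j hj]; rewrite /= -?[LHS]/(c *: u.1 + v.1).
  by rewrite u0 v0 scaler0 addr0.
by rewrite -[LHS]/(c *: u.2 j + v.2 j) uj // vj // scaler0 addr0.
Qed.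
Fact aff_filtMl k a u : aff_filt_set k u -> aff_filt_set k (a ** u).
Proof.
move=> [u0 uj]; split=> // -[|j] hj //.
by rewrite aff_mul2_S u0 scale0r subr0 uj ?scaler0 // ltnW.
Qed.
Fact aff_filtMr k a u : aff_filt_set k u -> aff_filt_set k (u ** a).
Proof.
move=> [u0 uj]; split=> // -[|j] hj //.
by rewrite aff_mul2_S u0 scale0r sub0r uj ?scaler0 ?oppr0 // ltnW.
Qed.

Definition aff_filt k : ideal (aff V) :=
  @Ideal rat (aff V) (Subspace (@aff_filt0 k) (@aff_filtP k))
    (@aff_filtMl k) (@aff_filtMr k).

End Affine.

(** * Representations of the holonomy Lie algebra *)

Section Completion.
Variables (K : fieldType) (A : naAlgType K) (F : nat -> ideal A).
Hypothesis F_decr : forall k l a, (k <= l)%N -> F l a -> F k a.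
Implicit Types x y : completion F.

Lemma cmpl_val_le k l x a : (k <= l)%N -> x l = qproj (F l) a -> x k = qproj (F k) a.
Proof.
move=> /subnK <-; elim: (l - k)%N => [|m IH] // e.
have [b [e1 e2]] := cmpl_valP x (m + k); apply: IH; rewrite e2.
apply/qprojP; apply: (F_decr (leqnSn _)); apply/qprojP.
by rewrite -e1 -e.
Qed.

Fact cmpl_const_compat (a : A) k :
  exists b, qproj (F k.+1) a = qproj (F k.+1) b /\ qproj (F k) a = qproj (F k) b.
Proof. by exists a. Qed.

Definition cmpl_const (a : A) : completion F := Completion (cmpl_const_compat a).

Fact cmpl_const_is_linear : linear cmpl_const.
Proof. by move=> c a b; apply/cmpl_eqP => k /=; rewrite linearP. Qed.
HB.instance Definition _ := GRing.isLinear.Build K A (completion F) _ cmpl_const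
  cmpl_const_is_linear.

Lemma cmpl_constM : {morph cmpl_const : a b / a ** b}.
Proof. by move=> a b; apply/cmpl_eqP => k; apply/esym/qmulE. Qed.

Section Functional.
Variables (V : lmodType K) (f : {linear A -> V}) (d : nat).
Hypothesis fF : forall a, F d a -> f a = 0.

Definition cmpl_functional : {linear completion F -> V} :=
  [the {linear _ -> _} of qlift fF] \o [the {linear _ -> _} of @cmpl_comp _ _ F d].

Lemma cmpl_functionalE x k a :
  (d <= k)%N -> x k = qproj (F k) a -> cmpl_functional x = f a.
Proof. by move=> h /(cmpl_val_le h) e; rewrite /= /cmpl_comp e qliftE. Qed.

Lemma cmpl_functional_filt k x : (d <= k)%N -> cmpl_filt k x -> cmpl_functional x = 0.
Proof.
move=> h x0; by rewrite (@cmpl_functionalE x k 0) ?linear0.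
Qed.

End Functional.

Lemma cmpl_const_approx k x : exists a, cmpl_filt k (x - cmpl_const a).
Proof.
exists (repr (x k)); rewrite /cmpl_filt /= -[LHS]/(x k - qproj (F k) (repr (x k))).
by rewrite qproj_repr subrr.
Qed.

End Completion.

Section Holonomy.
Variables (V : lmodType rat) (n : nat) (R : set (free_lie rat n)).
Variables (s : 'I_n -> rat) (v : 'I_n -> V).

Fixpoint tree_val (t : free_magma n) : aff V :=
  match t with
  | Leaf i => (s i, fun j => if j is 0%N then v i else 0)
  | Node l r => tree_val l ** tree_val r
  end.

Lemma leaves_gt0 (t : free_magma n) : (0 < leaves t)%N.
Proof. by elim: t => //= l hl r hr; rewrite addn_gt0 hl. Qed.

Lemma tree_val_degree t :
  (leaves t <> 1%N -> (tree_val t).1 = 0) /\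
  (forall j, leaves t <> j.+1 -> (tree_val t).2 j = 0).
Proof.
elim: t => [i|l [l1 l2] r [r1 r2]] /=; first by split=> // -[|j].
split=> // -[|j] // hj; have := leaves_gt0 l; have := leaves_gt0 r => r0 l0.
have [e|/eqP ne] := eqVneq (leaves l) 1%N.
  have -> : (tree_val r).2 j = 0 by apply: r2 => e'; apply: hj; rewrite e e'.
  rewrite scaler0 sub0r; have [e'|/eqP ne] := eqVneq (leaves r) 1%N.
    by rewrite l2 ?scaler0 ?oppr0 // => e''; apply: hj; rewrite e' e'' addn1.
  by rewrite r1 // scale0r oppr0.
rewrite l1 // scale0r sub0r; have [e'|/eqP ne'] := eqVneq (leaves r) 1%N.
  by rewrite l2 ?scaler0 ?oppr0 // => e''; apply: hj; rewrite e' e'' addn1.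
by rewrite r1 // scale0r oppr0.
Qed.

Definition magma_val : {malg rat[free_magma n]} -> aff V := malg_lift tree_val.
HB.instance Definition _ := GRing.Linear.on magma_val.

Lemma magma_valU t : magma_val << t >> = tree_val t.
Proof. exact: malg_liftU. Qed.

Lemma magma_valM : {morph magma_val : a b / a ** b}.
Proof.
move=> a b; pose mv : {linear {malg rat[free_magma n]} -> aff V} := magma_val.
have mulU t u : << t >> ** << u >> = << Node t u >> :> {malg rat[free_magma n]}.
  by rewrite [LHS]malg_liftU malg_liftU.
apply: (@malg_linear_ext rat _ _
  [the {linear _ -> _} of mv \o [the {linear _ -> _} of rmul_by b]]
  [the {linear _ -> _} of [the {linear _ -> _} of rmul_by (mv b)] \o mv]) => t /=.
apply: (@malg_linear_ext rat _ _
  [the {linear _ -> _} of mv \o [the {linear _ -> _} of lmul_by << t >>]]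
  [the {linear _ -> _} of [the {linear _ -> _} of lmul_by (mv << t >>)] \o mv]) => u /=.
rewrite /lmul_by mulU -[LHS]/(magma_val _) -[RHS]/(magma_val _ ** magma_val _).
by rewrite !magma_valU.
Qed.

Lemma magma_val_lie a : ideal_gen (@lie_axioms rat n) a -> magma_val a = 0.
Proof.
apply: (ideal_gen_preim magma_valM (J := ideal_null _)) => _ [[x ->]|[x [y [z ->]]]].
  apply: (etrans (magma_valM x x)); exact: aff_alt.
have D b c : magma_val (b + c) = magma_val b + magma_val c by exact: linearD.
have E p q r : magma_val (p + q + r) = magma_val p + magma_val q + magma_val r.
  by rewrite D D.
have M2 p q r : magma_val (p ** (q ** r)) =
    magma_val p ** (magma_val q ** magma_val r).
  by rewrite magma_valM magma_valM.
apply: (etrans (E _ _ _)).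
exact: (etrans (f_equal3 (fun a b c => a + b + c) (M2 x y z) (M2 y z x) (M2 z x y))
  (aff_jacobi _ _ _)).
Qed.

Definition free_lie_val : free_lie rat n -> aff V := qlift magma_val_lie.
HB.instance Definition _ := GRing.Linear.on free_lie_val.

Lemma free_lie_valE a : free_lie_val (qproj _ a) = magma_val a.
Proof. exact: qliftE. Qed.

Lemma free_lie_valM : {morph free_lie_val : a b / a ** b}.
Proof. exact: (qliftM magma_val_lie magma_valM). Qed.

Hypothesis R_quad : forall x, R x -> free_lie_homog 2 x.
Hypothesis R_coef : forall x, R x -> (free_lie_val x).2 1%N = 0.

Lemma magma_val_coef j a :
  (magma_val a).2 j = malg_lift (fun t => (tree_val t).2 j) a.
Proof. exact: (linear_malg_lift (@aff_coef V j) tree_val a). Qed.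

(** The bound [1 < k] is there because [aff_filt] kills the coordinate of x for every [k]. *)
Lemma magma_val_homog k l a : (1 < k)%N -> (k <= l)%N ->
  (forall t, t \in msupp a -> leaves t = l) -> aff_filt V k (magma_val a).
Proof.
move=> k1 kl ha; rewrite /magma_val /malg_lift big_seq.
elim/big_ind: _ => [|x y|t /ha ht].
- exact: subspace0.
- exact: (@subspaceD _ _ (aff_filt V k)).
apply: (@subspaceZ _ _ (aff_filt V k)).
have [h1 h2] := tree_val_degree t.
by split=> [|j hj]; [apply: h1; rewrite ht; lia | apply: h2; rewrite ht; lia].
Qed.

(** By degree, a quadratic relation can be nonzero only in V x, the coefficient covered by [R_coef].
    A relation of higher degree would constrain a higher power of x. *)
Lemma free_lie_val_R x : ideal_gen R x -> free_lie_val x = 0.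
Proof.
apply: (ideal_gen_preim free_lie_valM (J := ideal_null _)) => y Ry.
have [a ha ey] := R_quad Ry; have ey1 := R_coef Ry.
have ea : free_lie_val y = magma_val a by rewrite ey free_lie_valE.
have [] := @magma_val_homog 2 2 a isT isT ha; rewrite -ea => y0 yj.
have yS j : (free_lie_val y).2 j.+2 = 0.
  rewrite ea magma_val_coef malg_lift_eq0 // => t /ha ht.
  by have [_ ->] := tree_val_degree t; rewrite ?ht.
apply: aff_eqP => [|[|[|j]]]; [exact: y0 | exact: yj | exact: ey1 | exact: yS].
Qed.

Definition holonomy_val : quad_lie R -> aff V := qlift free_lie_val_R.
HB.instance Definition _ := GRing.Linear.on holonomy_val.

Lemma holonomy_valE a : holonomy_val (qproj _ a) = free_lie_val a.
Proof. exact: qliftE. Qed.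

Lemma holonomy_valM : {morph holonomy_val : a b / a ** b}.
Proof. exact: (qliftM free_lie_val_R free_lie_valM). Qed.

Lemma holonomy_val_filt k x :
  (1 < k)%N -> quad_lie_filt R k x -> aff_filt V k (holonomy_val x).
Proof.
move=> k1; apply: (ideal_gen_preim holonomy_valM) => _ [l [_ [kl [a ha ->] ->]]].
rewrite -[X in aff_filt V k X]/(holonomy_val (qproj _ (qproj _ a))).
by rewrite holonomy_valE free_lie_valE; apply: magma_val_homog ha.
Qed.

End Holonomy.

Lemma quad_lie_filt_le n (R : set (free_lie rat n)) k l x :
  (k <= l)%N -> quad_lie_filt R l x -> quad_lie_filt R k x.
Proof.
move=> kl; move: x; apply: ideal_gen_min => _ [j [y [lj hy ->]]]; apply: ideal_gen_sub.
by exists j, y; split=> //; apply: leq_trans kl lj.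
Qed.

(** * Functionals on the completed group algebra *)

Section AdditiveFunctionals.
Variable G : groupType.

Lemma malg_liftM (V : lmodType rat) (h : G -> V) (a b : {malg rat[G]}) :
  malg_lift h (a ** b) =
  malg_lift (fun x => malg_lift (fun y => h (x * y)%g) b) a.
Proof.
rewrite [LHS]linear_malg_lift; congr malg_lift; apply/funext => x /=.
rewrite [LHS]linear_malg_lift; congr malg_lift; apply/funext => y /=.
exact: malg_liftU.
Qed.

Lemma malg_lift_scale (V : lmodType rat) (c : G -> rat^o) (w : V) (a : {malg rat[G]}) :
  malg_lift (fun x => c x *: w) a = (@malg_lift rat G rat^o c a : rat) *: w.
Proof.
rewrite /malg_lift; elim/big_rec2: _ => [|t x y _ ->]; first by rewrite scale0r.
by rewrite [RHS]scalerDl scalerA.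
Qed.

Lemma augM (a b : {malg rat[G]}) : aug (a ** b) = aug a * aug b.
Proof.
rewrite /aug malg_liftM; apply: etrans (@malg_lift_scale rat^o (fun=> 1) (aug b) a).
by apply: malg_lift_eq_in => x _; rewrite scale1r.
Qed.

Lemma aug_pow1_aug (a : {malg rat[G]}) : aug_pow rat G 1 a -> aug a = 0.
Proof.
apply: (aug_powS_ind (U := subspace_preim
  [the {linear {malg rat[G]} -> rat^o} of malg_lift (fun=> 1)] (subspace_null _))).
move=> x b _; rewrite -[subspace_preim _ _ _]/(aug _ = 0) augM.
by rewrite augB !augU subrr mul0r.
Qed.

Section Additive.
Variables (V : lmodType rat) (h : G -> V).
Hypothesis hM : forall x y, h (x * y)%g = h x + h y.

Lemma additive_liftM (a b : {malg rat[G]}) :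
  malg_lift h (a ** b) = aug b *: malg_lift h a + aug a *: malg_lift h b.
Proof.
rewrite malg_liftM -malg_lift_fZ -malg_lift_const -malg_lift_fD.
congr malg_lift; apply/funext => x; rewrite -malg_lift_const -malg_lift_fD.
by congr malg_lift; apply/funext => y.
Qed.

Lemma additive_lift_aug_pow2 (a : {malg rat[G]}) :
  aug_pow rat G 2 a -> malg_lift h a = 0.
Proof.
apply: (aug_powS_ind (U := subspace_preim (malg_lift h) (subspace_null V))).
move=> x b /aug_pow1_aug b0; rewrite -[subspace_preim _ _ _]/(malg_lift h _ = 0).
by rewrite additive_liftM b0 augB !augU subrr !scale0r addr0.
Qed.

Definition additive_hat : {linear cgalg rat G -> V} :=
  cmpl_functional additive_lift_aug_pow2.

Lemma additive_hatE (x : cgalg rat G) k a : (1 < k)%N -> x k = qproj (aug_pow rat G k) a ->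
  additive_hat x = malg_lift h a.
Proof. exact: (cmpl_functionalE (@aug_pow_le rat G)). Qed.

Lemma additive_hat_clog g : additive_hat (clog g) = h g.
Proof.
rewrite (@additive_hatE (clog g) 2 (glog 2 g)) //.
rewrite /glog /unip_log -deriv_at0_linear -[RHS](@deriv_at0_id _ 2 (h g)) //.
apply: eq_deriv_at0 => n /=; rewrite malg_liftU; elim: n => [|n IH].
  apply: (@addrI _ (h 1%g)).
  by rewrite expg0 scale0r addr0 -hM mulg1.
by rewrite expgS hM IH -natr1 scalerDl scale1r addrC.
Qed.

End Additive.

Variables (V : lmodType rat) (chi : G -> rat^o) (alpha beta : G -> V).
Hypothesis chiM : forall x y, chi (x * y)%g = chi x + chi y.
Hypothesis alphaM : forall x y, alpha (x * y)%g = alpha x + alpha y.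
Hypothesis betaM : forall x y,
  beta (x * y)%g = beta x + beta y + (chi x : rat) *: alpha y.

(** [chi], [alpha] and [beta] behave as the entries (1,2), (2,3) and (1,3) of a unipotent 3 by 3
    matrix; this is the product rule for the corner entry. *)
Lemma massey_liftM (a b : {malg rat[G]}) : malg_lift beta (a ** b) =
  aug b *: malg_lift beta a + aug a *: malg_lift beta b +
  (@malg_lift rat G rat^o chi a : rat) *: malg_lift alpha b.
Proof.
rewrite malg_liftM -malg_lift_fZ -malg_lift_const -malg_lift_scale -!malg_lift_fD.
congr malg_lift; apply/funext => x.
rewrite -malg_lift_const -malg_lift_fZ -!malg_lift_fD.
by congr malg_lift; apply/funext => y.
Qed.

Lemma massey_lift_aug_pow3 (a : {malg rat[G]}) :
  aug_pow rat G 3 a -> malg_lift beta a = 0.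
Proof.
apply: (aug_powS_ind (U := subspace_preim (malg_lift beta) (subspace_null V))).
move=> x b hb; have b0 := aug_pow1_aug (aug_pow_leS hb).
rewrite -[subspace_preim _ _ _]/(malg_lift beta _ = 0) massey_liftM b0.
by rewrite (additive_lift_aug_pow2 alphaM hb) augB !augU subrr !scale0r scaler0 !addr0.
Qed.

Definition massey_hat : {linear cgalg rat G -> V} :=
  cmpl_functional massey_lift_aug_pow3.

Lemma massey_hatE (x : cgalg rat G) k a : (2 < k)%N -> x k = qproj (aug_pow rat G k) a ->
  massey_hat x = malg_lift beta a.
Proof. exact: (cmpl_functionalE (@aug_pow_le rat G)). Qed.

Lemma cgalg_commE (x y : cgalg rat G) k a b :
  x k = qproj _ a -> y k = qproj _ b ->
  (x ** y - y ** x) k = qproj (aug_pow rat G k) (a ** b - b ** a).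
Proof.
move=> ex ey; apply: (etrans _ (esym (linearB _ _ _))).
have qM c d := qmulE (aug_pow rat G k) c d.
apply: (@f_equal2 _ _ _ (fun u v => u - v)).
  by apply: (etrans _ (qM a b)); rewrite -ex -ey.
by apply: (etrans _ (qM b a)); rewrite -ex -ey.
Qed.

Lemma additive_hat_comm (h : G -> V) (hM : forall x y, h (x * y)%g = h x + h y) x y :
  additive_hat hM (x ** y - y ** x) = 0.
Proof.
have ex := esym (qproj_repr (x 2%N)); have ey := esym (qproj_repr (y 2%N)).
rewrite (additive_hatE hM _ (cgalg_commE ex ey)) //.
apply: (etrans (linearB (malg_lift h) _ _)).
apply/eqP; rewrite subr_eq0; apply/eqP.
set a := repr (x 2%N); set b := repr (y 2%N).
apply: (etrans (additive_liftM hM a b)); apply: (etrans (addrC _ _)).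
exact: (esym (additive_liftM hM b a)).
Qed.

(** The symmetric terms of [massey_liftM] cancel, leaving the cup product of [chi] and [alpha]
    evaluated on [x] and [y]. *)
Lemma massey_hat_comm x y : massey_hat (x ** y - y ** x) =
  (additive_hat chiM x : rat) *: additive_hat alphaM y -
  (additive_hat chiM y : rat) *: additive_hat alphaM x.
Proof.
have ex := esym (qproj_repr (x 3%N)); have ey := esym (qproj_repr (y 3%N)).
rewrite (massey_hatE _ (cgalg_commE ex ey)) //.
rewrite !(additive_hatE _ _ ex) // !(additive_hatE _ _ ey) //.
apply: (etrans (linearB (malg_lift beta) _ _)).
set a := repr (x 3%N); set b := repr (y 3%N).
apply: (etrans (f_equal2 (fun u v => u - v) (massey_liftM a b) (massey_liftM b a))).
by rewrite [X in _ - (X + _)]addrC opprD addrACA subrr add0r.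
Qed.

End AdditiveFunctionals.

(** * Unbounded chains of homomorphisms on the kernel *)

Section OneFormal.
Variables (G : groupType) (V : lmodType rat).
Variables (chi : G -> rat^o) (alpha beta : G -> V).
Hypothesis chiM : forall x y, chi (x * y)%g = chi x + chi y.
Hypothesis alphaM : forall x y, alpha (x * y)%g = alpha x + alpha y.
Hypothesis betaM : forall x y,
  beta (x * y)%g = beta x + beta y + (chi x : rat) *: alpha y.

Variables (n : nat) (R : set (free_lie rat n)).
Hypothesis R_quad : forall x, R x -> free_lie_homog 2 x.
Variable f : {linear completion (quad_lie_filt R) -> cgalg rat G}.
Hypothesis f_inj : injective f.
Hypothesis f_range : range f = @malcev rat G.
Hypothesis fM : forall x y, f (x ** y) = f x ** f y - f y ** f x.
Hypothesis f_filt : forall k x, cmpl_filt k x <-> cmpl_filt k (f x).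

Local Notation lie := (completion (quad_lie_filt R)).

Definition lie_of (a : {malg rat[free_magma n]}) : lie :=
  cmpl_const (quad_lie_filt R) (qproj _ (qproj _ a)).

Fact lie_of_is_linear : linear lie_of.
Proof.
move=> c a b; apply: (etrans _ (linearP (cmpl_const _) c _ _)).
apply: (congr1 (cmpl_const _)); apply: (etrans _ (linearP (qproj _) c _ _)).
apply: (congr1 (qproj _)); exact: (linearP (qproj _) c a b).
Qed.
HB.instance Definition _ := GRing.isLinear.Build rat {malg rat[free_magma n]} lie _
  lie_of lie_of_is_linear.

Lemma lie_ofM a b : lie_of (a ** b) = lie_of a ** lie_of b.
Proof.
apply: (etrans _ (cmpl_constM _ _ _)); apply: (congr1 (cmpl_const _)).
apply: (etrans _ (esym (qmulE _ _ _))); apply: (congr1 (qproj _)).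
exact: (esym (qmulE _ a b)).
Qed.

Lemma lie_of_node l r : lie_of << Node l r >> = lie_of << l >> ** lie_of << r >>.
Proof.
apply: (etrans _ (lie_ofM << l >> << r >>)); apply: (congr1 lie_of).
by apply: esym; rewrite [LHS]malg_liftU malg_liftU.
Qed.

Let chi_hat := additive_hat chiM.
Let alpha_hat := additive_hat alphaM.
Let s i : rat := chi_hat (f (lie_of << Leaf i >>)).
Let v i : V := alpha_hat (f (lie_of << Leaf i >>)).

(* The relations hold because [beta] exhibits the cup product of [chi] and
   [alpha] as a coboundary. *)
Lemma relation_coef x : R x -> (free_lie_val s v x).2 1%N = 0.
Proof.
move=> Rx; have [a ha ex] := R_quad Rx.
have e0 : free_lie_val s v x = magma_val s v a by rewrite ex; exact: free_lie_valE.
rewrite e0 magma_val_coef.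
have x0 : lie_of a = 0.
  rewrite /lie_of -ex (_ : qproj _ x = 0) ?linear0 // -(linear0 (qproj _)).
  by apply/qprojP; rewrite subr0; apply: ideal_gen_sub.
transitivity (massey_hat alphaM betaM (f (lie_of a))); last first.
  by rewrite x0 !linear0.
rewrite -[a in RHS]malg_lift_id linear_malg_lift linear_malg_lift linear_malg_lift.
apply: malg_lift_eq_in => -[i|[i|l l'] [j|r r']] /ha //=; last first.
- by have := leaves_gt0 l; have := leaves_gt0 l'; have := leaves_gt0 r; lia.
- by have := leaves_gt0 l; have := leaves_gt0 l'; lia.
- by have := leaves_gt0 r; have := leaves_gt0 r'; lia.
move=> _; rewrite lie_of_node fM.
exact: (esym (massey_hat_comm chiM alphaM betaM _ _)).
Qed.

Let hval := holonomy_val R_quad relation_coef.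

Let hvalM a b : hval (a ** b) = hval a ** hval b.
Proof. exact: holonomy_valM. Qed.

Lemma lie_coefA k a : quad_lie_filt R k.+2 a ->
  ([the {linear _ -> _} of @aff_coef V k] \o hval) a = 0.
Proof. by move=> /(@holonomy_val_filt _ _ _ _ _ R_quad relation_coef k.+2 a isT) [_]; apply. Qed.

Definition lie_coef k : {linear lie -> V} := cmpl_functional (@lie_coefA k).

Lemma lie_fstA a : quad_lie_filt R 2 a ->
  ([the {linear _ -> _} of @aff_fst V] \o hval) a = 0.
Proof. by move=> /(@holonomy_val_filt _ _ _ _ _ R_quad relation_coef 2 a isT) []. Qed.

Definition lie_fst : {linear lie -> rat^o} := cmpl_functional lie_fstA.

Let decr := @quad_lie_filt_le n R.

Lemma lie_coef_filt k l x : (k.+1 < l)%N -> cmpl_filt l x -> lie_coef k x = 0.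
Proof. exact: (cmpl_functional_filt decr). Qed.

Lemma lie_coefE k l (x : lie) a : (k.+1 < l)%N -> x l = qproj _ a ->
  lie_coef k x = (hval a).2 k.
Proof. by move=> h /(cmpl_functionalE decr (@lie_coefA k) h). Qed.

Lemma lie_fstE l (x : lie) a : (1 < l)%N -> x l = qproj _ a ->
  lie_fst x = (hval a).1.
Proof. by move=> h /(cmpl_functionalE decr lie_fstA h). Qed.

Lemma lie_coef_mul0 x y : lie_coef 0 (x ** y) = 0.
Proof.
have ex := esym (qproj_repr (x 2%N)); have ey := esym (qproj_repr (y 2%N)).
have exy : (x ** y) 2%N = qproj _ (repr (x 2%N) ** repr (y 2%N)).
  by apply: (etrans _ (qmulE _ _ _)); rewrite -ex -ey.
rewrite (lie_coefE _ exy) //.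
by rewrite hvalM aff_mul2_0.
Qed.

Lemma lie_coef_mulS k x y : lie_coef k.+1 (x ** y) =
  (lie_fst x : rat) *: lie_coef k y - (lie_fst y : rat) *: lie_coef k x.
Proof.
have ex := esym (qproj_repr (x k.+3)); have ey := esym (qproj_repr (y k.+3)).
have exy : (x ** y) k.+3 = qproj _ (repr (x k.+3) ** repr (y k.+3)).
  by apply: (etrans _ (qmulE _ _ _)); rewrite -ex -ey.
rewrite (lie_coefE _ exy) // !(lie_fstE _ ex) // !(lie_fstE _ ey) //.
rewrite (lie_coefE _ ex) // (lie_coefE _ ey) //.
by rewrite hvalM aff_mul2_S.
Qed.

(** Elements coming from the free algebra are dense, and vanishing on [cmpl_filt 2] stands for
    continuity. *)
Lemma lie_linear_eq (W : lmodType rat) (p q : {linear lie -> W}) :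
  (forall x, cmpl_filt 2 x -> p x = 0) -> (forall x, cmpl_filt 2 x -> q x = 0) ->
  (forall t, p (lie_of << t >>) = q (lie_of << t >>)) -> p =1 q.
Proof.
move=> p0 q0 e x; have [y hy] := cmpl_const_approx 2 x.
have [b eb] := qproj_surj y; have [a ea] := qproj_surj b.
rewrite -[x](subrK (cmpl_const (quad_lie_filt R) y)).
rewrite (linearD p) (linearD q).
apply: (@f_equal2 _ _ _ +%R); first exact: etrans (p0 _ hy) (esym (q0 _ hy)).
rewrite eb ea.
exact: (malg_linear_ext (f := [the {linear _ -> _} of p \o lie_of])
  (g := [the {linear _ -> _} of q \o lie_of]) e).
Qed.

Lemma hvalE t : hval (qproj _ (qproj _ << t >>)) = tree_val s v t.
Proof.
apply: (etrans (holonomy_valE R_quad relation_coef _)).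
apply: (etrans (free_lie_valE s v _)); exact: magma_valU.
Qed.

Lemma additive_hat_filt (W : lmodType rat) (h : G -> W)
    (hM : forall x y, h (x * y)%g = h x + h y) x :
  cmpl_filt 2 x -> additive_hat hM (f x) = 0.
Proof. by move=> /f_filt; apply: (cmpl_functional_filt (@aug_pow_le rat G)). Qed.

(** Both sides vanish on brackets and agree on the generators by the choice of [s]; the choice of
    [v] plays this part for [lie_coef0_alpha]. *)
Lemma lie_fst_chi x : lie_fst x = chi_hat (f x).
Proof.
apply: (lie_linear_eq (q := [the {linear _ -> _} of chi_hat \o f])) => {x} [x|x|t].
- exact: (cmpl_functional_filt decr).
- exact: additive_hat_filt.
rewrite (@lie_fstE 2 _ (qproj _ (qproj _ << t >>))) // hvalE /=.
case: t => [i|l r] //=; rewrite lie_of_node fM; apply/esym; exact: additive_hat_comm.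
Qed.

Lemma lie_coef0_alpha x : lie_coef 0 x = alpha_hat (f x).
Proof.
apply: (lie_linear_eq (q := [the {linear _ -> _} of alpha_hat \o f])) => {x} [x|x|t].
- exact: (cmpl_functional_filt decr).
- exact: additive_hat_filt.
rewrite (@lie_coefE 0 2 _ (qproj _ (qproj _ << t >>))) // hvalE /=.
case: t => [i|l r] //=; rewrite lie_of_node fM; apply/esym; exact: additive_hat_comm.
Qed.

Lemma lie_log_exists (g : G) : exists x, f x = clog g.
Proof.
have : @malcev rat G (clog g) by exact: clog_malcev.
by rewrite -f_range => -[x _ <-]; exists x.
Qed.

Definition lie_log (g : G) : lie := sval (cid (lie_log_exists g)).

Lemma f_lie_log g : f (lie_log g) = clog g.
Proof. exact: (svalP (cid (lie_log_exists g))). Qed.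

Lemma lie_logX g m : lie_log (g ^+ m)%g = m%:R *: lie_log g.
Proof. by apply: f_inj; rewrite linearZ /= !f_lie_log clogX. Qed.

Lemma lie_log_conj d g h : cmpl_filt d
  (deriv_at0 d (fun m => lie_log (h ^+ m * g * h ^- m)%g) - lie_log h ** lie_log g).
Proof.
apply/f_filt; rewrite linearB /= fM !f_lie_log -deriv_at0_linear.
rewrite (@eq_deriv_at0 _ d _ (fun m => clog (h ^+ m * g * h ^- m)%g)); last first.
  by move=> m; apply: f_lie_log.
exact: clog_conj.
Qed.

Lemma lie_log_lift d a : aug_pow rat G d a -> cmpl_filt d (malg_lift lie_log a).
Proof.
move=> ha; apply/f_filt; rewrite linear_malg_lift.
by rewrite (_ : f \o lie_log = @clog G); [apply: clog_lift | apply/funext; exact: f_lie_log].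
Qed.

Definition log_coord k (g : G) : V := lie_coef k (lie_log g).

Lemma log_coord0 g : log_coord 0 g = alpha g.
Proof. by rewrite /log_coord lie_coef0_alpha f_lie_log additive_hat_clog. Qed.

Lemma lie_fst_log g : lie_fst (lie_log g) = chi g.
Proof. by rewrite lie_fst_chi f_lie_log additive_hat_clog. Qed.

Lemma log_coordX k g m : log_coord k (g ^+ m)%g = m%:R *: log_coord k g.
Proof. by rewrite /log_coord lie_logX linearZ. Qed.

Lemma log_coord_aug k d a : (k.+1 < d)%N -> aug_pow rat G d a ->
  malg_lift (log_coord k) a = 0.
Proof.
move=> kd /lie_log_lift ha; rewrite -[LHS]linear_malg_lift.
exact: lie_coef_filt kd ha.
Qed.

Lemma deriv_log_coord k d g h : (k.+1 < d)%N ->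
  deriv_at0 d (fun m => log_coord k (h ^+ m * g * h ^- m)%g) =
  lie_coef k (lie_log h ** lie_log g).
Proof.
move=> kd; pose t m := lie_log (h ^+ m * g * h ^- m)%g.
apply: (etrans (deriv_at0_linear (lie_coef k) d t)).
apply/eqP; rewrite -subr_eq0; apply/eqP; apply: (etrans (esym (linearB (lie_coef k) _ _))).
exact: lie_coef_filt kd (lie_log_conj d g h).
Qed.

Lemma deriv_log_coordS k d g h : (k.+2 < d)%N ->
  deriv_at0 d (fun m => log_coord k.+1 (h ^+ m * g * h ^- m)%g) =
  (chi h : rat) *: log_coord k g - (chi g : rat) *: log_coord k h.
Proof. by move=> kd; rewrite deriv_log_coord // lie_coef_mulS !lie_fst_log. Qed.

Lemma log_coord_fdiff k d g h m : (k.+1 < d)%N ->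
  iter d (@fdiff V) (fun m => log_coord k (h ^+ m * g * h ^- m)%g) m = 0.
Proof.
move=> kd; rewrite -[RHS](log_coord_aug kd (iter_fdiff_gelt_conj d g h m)).
rewrite -iter_fdiff_linear; congr (iter d _ _ m).
by apply/funext => l; apply/esym; apply: malg_liftU.
Qed.

Lemma chi_kerV x : chi x = 0 -> chi x^-1%g = 0.
Proof.
have chi1 : chi 1%g = 0 by apply: (@addrI _ (chi 1%g)); rewrite -chiM mulg1 addr0.
by move=> x0; apply: (@addrI _ (chi x)); rewrite -chiM mulgV x0 add0r.
Qed.

(** The derivative along conjugation by [y] only involves multiples of [chi y] and [chi x], so it
    vanishes on the kernel and the conjugates of [x] by powers of [y] all have the same
    coordinate. *)
Lemma log_coordJ k x y : chi x = 0 -> chi y = 0 ->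
  log_coord k (y * x * y^-1)%g = log_coord k x.
Proof.
move=> x0 y0; pose u m := log_coord k (y ^+ m * x * y ^- m)%g.
have ker m : chi (y ^+ m * x * y ^- m)%g = 0.
  have yX l : chi (y ^+ l)%g = 0.
    elim: l => [|l IH]; last by rewrite expgS chiM IH y0 addr0.
    by rewrite expg0 -(mulgV y) chiM y0 chi_kerV // addr0.
  by rewrite !chiM chi_kerV ?yX // x0 !addr0.
have h d : (k.+1 < d)%N -> forall a, deriv_at0 d (fun m => u (a + m)%N) = 0.
  move=> kd a.
  (* Shifting by [a] replaces [x] by its conjugate under y^a, which is still in the kernel. *)
  rewrite (@eq_deriv_at0 _ _ _ (fun m =>
    log_coord k (y ^+ m * (y ^+ a * x * y ^- a) * y ^- m)%g)); last first.
    by move=> m; rewrite /u addnC expgnDr invgM !mulgA.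
  case: k kd => [|k'] kd in u *.
    by rewrite deriv_log_coord // lie_coef_mul0.
  by rewrite deriv_log_coordS // y0 ker !scale0r subrr.
have := deriv_at0_shift_eq0 _ (h k.+2 (leqnn _)).
move=> /(_ (fun a => log_coord_fdiff x y a (leqnn _))) /(_ 1%N).
by rewrite /u expg1 expg0 mul1g invg1 mulg1.
Qed.

Lemma log_coordM k x y : chi x = 0 -> chi y = 0 ->
  log_coord k (x * y)%g = log_coord k x + log_coord k y.
Proof.
apply: (@polynomial_class_functionM G V (fun x => chi x = 0) _ k.+2) => //.
- by move=> a b a0 b0; rewrite chiM a0 b0 addr0.
- exact: chi_kerV.
- by move=> a m _; apply: log_coordX.
- exact: log_coordJ.
- by move=> a; apply: log_coord_aug.
Qed.

End OneFormal.

Theorem one_formal_chain (G : groupType) (V : lmodType rat)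
    (chi : G -> rat^o) (alpha beta : G -> V) :
  (forall x y, chi (x * y)%g = chi x + chi y) ->
  (forall x y, alpha (x * y)%g = alpha x + alpha y) ->
  (forall x y, beta (x * y)%g = beta x + beta y + (chi x : rat) *: alpha y) ->
  one_formal G ->
  exists u : nat -> G -> V,
    [/\ forall g, u 0%N g = alpha g,
        forall k x y, chi x = 0 -> chi y = 0 -> u k (x * y)%g = u k x + u k y &
        forall k d g h, (k.+2 < d)%N -> chi g = 0 ->
          deriv_at0 d (fun m => u k.+1 (h ^+ m * g * h ^- m)%g) =
          (chi h : rat) *: u k g].
Proof.
move=> chiM alphaM betaM [n [R [R_quad [f [f_inj f_range fM f_filt]]]]].
exists (log_coord chiM alphaM betaM R_quad f_range fM).
split=> [g|k x y x0 y0|k d g h kd g0]; first exact: log_coord0.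
- exact: log_coordM.
by rewrite deriv_log_coordS // g0 scale0r subr0.
Qed.

(** * Independence of the chain *)

(** An alias carrying the restriction of scalars of [F] to [rat], so that [F] can serve as the
    coefficient space V. *)
Definition ratmod (F : numFieldType) : Type := F.

Section RatMod.
Variable F : numFieldType.

HB.instance Definition _ := GRing.Zmodule.on (ratmod F).

Definition ratmod_scale (q : rat) (x : ratmod F) : ratmod F := (ratr q : F) * x.

Fact ratmod_scaleA a b x : ratmod_scale a (ratmod_scale b x) = ratmod_scale (a * b) x.
Proof. by rewrite /ratmod_scale rmorphM mulrA. Qed.
Fact ratmod_scale1 : left_id 1 ratmod_scale.
Proof. by move=> x; rewrite /ratmod_scale rmorph1 mul1r. Qed.
Fact ratmod_scaleDr : right_distributive ratmod_scale +%R.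
Proof. by move=> a x y; apply: (mulrDr (ratr a : F)). Qed.
Fact ratmod_scaleDl x a b : ratmod_scale (a + b) x = ratmod_scale a x + ratmod_scale b x.
Proof. by rewrite /ratmod_scale rmorphD; apply: (mulrDl (_ : F)). Qed.
HB.instance Definition _ := GRing.Zmodule_isLmodule.Build rat (ratmod F)
  ratmod_scaleA ratmod_scale1 ratmod_scaleDr ratmod_scaleDl.

Definition ratmod_mul (c : F) (x : ratmod F) : ratmod F := c * (x : F).

Fact ratmod_mul_is_linear c : linear (ratmod_mul c).
Proof.
move=> a x y; rewrite /ratmod_mul -[LHS]/(c * ((ratr a : F) * x + y) : F).
by rewrite mulrDr mulrCA.
Qed.
HB.instance Definition _ c := GRing.isLinear.Build rat (ratmod F) (ratmod F) _
  (ratmod_mul c) (ratmod_mul_is_linear c).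

End RatMod.

(** Differentiating a relation along conjugation by powers of [t] kills u_0 and lowers the other
    indices by one. By induction on the length only c_0 can survive, and evaluating at [m0] removes
    it. *)
Theorem one_formal_independent (G : groupType) (F : numFieldType)
    (chi : G -> rat^o) (alpha beta : G -> F) (t m0 : G) :
  (forall x y, chi (x * y)%g = chi x + chi y) ->
  (forall x y, alpha (x * y)%g = alpha x + alpha y) ->
  (forall x y, beta (x * y)%g = beta x + beta y + ratr (chi x) * alpha y) ->
  one_formal G -> chi t = 1 -> chi m0 = 0 -> alpha m0 != 0 ->
  exists u : nat -> G -> F,
    (forall k x y, chi x = 0 -> chi y = 0 -> u k (x * y)%g = u k x + u k y) /\
    (forall e (c : nat -> F),
      (forall m, chi m = 0 -> \sum_(k < e) c k * u k m = 0) ->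
      forall k, (k < e)%N -> c k = 0).
Proof.
move=> chiM alphaM betaM formal t1 m00 am0.
have [u [u0 uM uS]] := @one_formal_chain G (ratmod F) chi alpha beta chiM alphaM betaM formal.
exists u; split=> //.
have chi1 : chi 1%g = 0 by apply: (@addrI _ (chi 1%g)); rewrite -chiM mulg1 addr0.
have chiV x : chi x^-1%g = - chi x.
  by apply: (@addrI _ (chi x)); rewrite -chiM mulgV chi1 subrr.
have conj0 x m : chi m = 0 -> chi (x * m * x^-1)%g = 0.
  by move=> m_0; rewrite !chiM chiV m_0 addr0 subrr.
have alphaJ x m : alpha (x * m * x^-1)%g = alpha m.
  by apply: (@addIr _ (alpha x)); rewrite -alphaM mulgVK alphaM addrC.
elim=> [|e IH] c hc k //.
have cS l : (l < e)%N -> c l.+1 = 0.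
  apply: (IH (fun l => c l.+1)) => m m_0.
  pose d := e.+3.
  have : deriv_at0 d (fun n => \sum_(k < e.+1)
      ratmod_mul (c k) (u k (t ^+ n * m * t ^- n)%g)) = 0.
    rewrite -[RHS](deriv_at0_const d (0 : ratmod F)); apply: eq_deriv_at0 => n.
    exact: hc (conj0 _ _ m_0).
  rewrite deriv_at0_sum big_ord_recl /=.
  have -> : deriv_at0 d (fun n => ratmod_mul (c 0%N) (u 0%N (t ^+ n * m * t ^- n)%g)) = 0.
    rewrite -[RHS](deriv_at0_const d (ratmod_mul (c 0%N) (alpha m))).
    by apply: eq_deriv_at0 => n; rewrite u0 alphaJ.
  have derivE (j : 'I_e) : deriv_at0 d (fun n =>
      ratmod_mul (c j.+1) (u j.+1 (t ^+ n * m * t ^- n)%g)) =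
      ratmod_mul (c j.+1) (u j m).
    apply: (etrans (deriv_at0_linear (ratmod_mul (c j.+1)) d
      (fun n => u j.+1 (t ^+ n * m * t ^- n)%g))).
    by rewrite uS ?t1 ?scale1r //; have := ltn_ord j; rewrite /d; lia.
  by rewrite add0r (eq_bigr _ (fun j _ => derivE j)).
case: k => [|k]; last by rewrite ltnS; apply: cS.
move=> _; have := hc m0 m00; rewrite big_ord_recl big1; last first.
  by move=> l _; rewrite cS ?mul0r.
by rewrite addr0 u0 => /eqP; rewrite mulf_eq0 (negPf am0) orbF => /eqP.
Qed.

(** * Homomorphisms to a field and first homology *)

Section AdditiveH1.
Variables (F : fieldType) (G : groupType) (a : G -> F).
Hypothesis aM : forall x y, a (x * y)%g = a x + a y.

Definition additive_ext : {linear {malg F[G]} -> F^o} :=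
  [the {linear _ -> _} of @malg_lift F G F^o a].

Lemma additive_extU g : additive_ext << g >> = a g.
Proof. exact: malg_liftU. Qed.

Lemma additive_ext_boundary x : boundary1 F G x -> additive_ext x = 0.
Proof.
move=> [c _ <-]; rewrite /bar_d2 linear_malg_lift /malg_lift big1 // => p _ /=.
rewrite -[X in _ *: X]/(additive_ext _) linearD linearB !additive_extU aM.
by rewrite opprD addrCA subrr addr0 addNr scaler0.
Qed.

Lemma additive_eq0 n (r : 'I_n -> {malg F[G]}) :
  (forall v : H1 F G, exists c, v = \sum_i c i *: qproj _ (r i)) ->
  (forall i, additive_ext (r i) = 0) -> forall g, a g = 0.
Proof.
move=> span r0 g; have [c ec] := span (qproj _ << g >>).
have eg : qproj (boundary1 F G) << g >> = qproj _ (\sum_i c i *: r i).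
  by rewrite ec linear_sum; apply: eq_bigr => i _; rewrite linearZ.
move/qprojP: eg => /additive_ext_boundary; rewrite linearB additive_extU => /eqP.
rewrite subr_eq0 => /eqP ->; rewrite linear_sum big1 // => i _.
apply: (etrans (linearZ _ _)); apply: (etrans (congr1 _ (r0 i))); exact: scaler0.
Qed.

End AdditiveH1.

Lemma b1_finite_span (F : fieldType) (G : groupType) : b1_finite F G ->
  exists n (r : 'I_n -> {malg F[G]}),
    forall v : H1 F G, exists c, v = \sum_i c i *: qproj _ (r i).
Proof.
move=> [n [e he]]; exists n, (fun i => repr (e i)) => v.
have [c [ec _]] := he v; exists c; rewrite ec.
by apply: eq_bigr => i _; rewrite qproj_repr.
Qed.

Lemma additive_ext_sum (F : fieldType) (G : groupType) e (u : nat -> G -> F)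
    (c : nat -> F) a :
  additive_ext (fun g => \sum_(k < e) c k * u k g) a =
  \sum_(k < e) c k * additive_ext (u k) a.
Proof.
rewrite /= /malg_lift; under [RHS]eq_bigr do rewrite mulr_sumr.
rewrite exchange_big; apply: eq_bigr => g _ /=; rewrite [LHS]mulr_sumr.
by apply: eq_bigr => k _; rewrite mulrCA.
Qed.

Lemma exists_kernel_vector (F : fieldType) e d (A : 'M[F]_(e, d)) : (d < e)%N ->
  exists2 v : 'rV[F]_e, v != 0 & v *m A = 0.
Proof.
move=> de; have : kermx A != 0.
  rewrite -mxrank_eq0 mxrank_ker subn_eq0 -ltnNge.
  exact: leq_ltn_trans (rank_leq_col A) de.
by case/rowV0Pn => v /sub_kermxP vA v0; exists v.
Qed.

(* At most [b_1(K) + b_1(N)] homomorphisms to [F] are independent on the preimage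
   of [N], which is an extension of [N] by [K]. *)
Lemma extension_dependent (F : fieldType) (N G K pi : groupType)
    (inc : {multiplicative N -> G}) (jnc : {multiplicative K -> pi})
    (chi : {multiplicative pi -> G}) (u : nat -> pi -> F) :
  injective inc -> short_exact jnc chi -> b1_finite F N -> b1_finite F K ->
  (forall k x y, (exists m, inc m = chi x) -> (exists m, inc m = chi y) ->
    u k (x * y)%g = u k x + u k y) ->
  exists e (c : nat -> F),
    (forall p, (exists m, inc m = chi p) -> \sum_(k < e) c k * u k p = 0) /\
    exists2 k, (k < e)%N & c k != 0.
Proof.
move=> inc_inj [jnc_inj chi_surj chi_ker].
move=> /b1_finite_span[nN [rN spanN]] /b1_finite_span[nK [rK spanK]] uM.
pose M p := exists m, inc m = chi p.
have /choice[lift liftE] m : exists p, chi p = inc m by apply: chi_surj.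
have chi_jnc x : chi (jnc x) = 1%g by apply/chi_ker; exists x.
have MK x : M (jnc x) by exists 1%g; rewrite chi_jnc gmorph1.
have ML m : M (lift m) by exists m.
pose d := (nK + nN)%N.
(* Row [k] holds the values of u_k on homology generators of [K] and [N]. One row more than columns
   forces a relation between the rows. *)
pose A : 'M[F]_(d.+1, d) := \matrix_(k, i) match fintype.split i with
  | inl i => additive_ext (u k \o jnc) (rK i)
  | inr i => additive_ext (u k \o lift) (rN i) end.
have [v v0 vA] := exists_kernel_vector A (ltnSn d).
pose c k := v 0 (inord k); pose w p := \sum_(k < d.+1) c k * u k p.
have wM x y : M x -> M y -> w (x * y)%g = w x + w y.
  by move=> Mx My; rewrite /w -big_split; apply: eq_bigr => k _; rewrite uM // mulrDr.
have vAE i : \sum_(k < d.+1) c k * A k i = 0.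
  have := congr1 (fun B : 'rV[F]_d => B 0 i) vA; rewrite mxE [RHS]mxE => e.
  by rewrite -[RHS]e; apply: eq_bigr => k _; rewrite /c inord_val.
have wK x : w (jnc x) = 0.
  apply: (additive_eq0 (a := w \o jnc) _ spanK) => [y z|i].
    by rewrite /= gmulfM wM.
  rewrite -(vAE (lshift nN i)) -[LHS]/(additive_ext (fun x => w (jnc x)) (rK i)).
  rewrite (additive_ext_sum d.+1 (fun k => u k \o jnc)); apply: eq_bigr => k _.
  by rewrite mxE (unsplitK (inl i)).
(* Vanishing on [K], [w] factors through [chi] there; hence [w \o lift] is additive although [lift]
   is only a set-theoretic section. *)
have wlift x y : M x -> chi x = chi y -> w x = w y.
  move=> Mx exy.
  have /chi_ker[z ez] : chi (x * y^-1)%g = 1%g by rewrite gmulfM gmorphV exy mulgV.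
  have My : M y by case: Mx => m em; exists m; rewrite em.
  by rewrite -[x](mulgVK y) -ez wM // wK add0r.
have wN m : w (lift m) = 0.
  apply: (additive_eq0 (a := w \o lift) _ spanN) => [y z|i].
    rewrite /= -wM //; apply: wlift => //.
    by rewrite gmulfM !liftE gmulfM.
  rewrite -(vAE (rshift nK i)) -[LHS]/(additive_ext (fun x => w (lift x)) (rN i)).
  rewrite (additive_ext_sum d.+1 (fun k => u k \o lift)); apply: eq_bigr => k _.
  by rewrite mxE (unsplitK (inr i)).
exists d.+1, c; split=> [p [m em]|].
  rewrite -[LHS]/(w p) -(wN m); apply: wlift; first by exists m.
  by rewrite liftE.
case/rV0Pn: v0 => i vi; exists (i : nat) => //.
by rewrite /c inord_val.
Qed.

(** * Jordan blocks and the final argument *)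

Section Basis.
Variables (F : fieldType) (V : lmodType F) (n : nat) (e : 'I_n -> V).
Hypothesis e_basis : is_basis e.

Definition coord_of (v : V) : 'I_n -> F := sval (cid (e_basis v)).

Lemma coord_ofE v : v = \sum_i coord_of v i *: e i.
Proof. by have [] := svalP (cid (e_basis v)). Qed.

Lemma coord_of_unique v c : v = \sum_i c i *: e i -> coord_of v = c.
Proof. by have [_ h] := svalP (cid (e_basis v)); exact: h. Qed.

Lemma coord_ofP c u v i : coord_of (c *: u + v) i = c * coord_of u i + coord_of v i.
Proof.
rewrite (@coord_of_unique _ (fun i => c * coord_of u i + coord_of v i)) //.
rewrite [in LHS](coord_ofE u) [in LHS](coord_ofE v) scaler_sumr -big_split.
by apply: eq_bigr => j _; rewrite scalerDl scalerA.
Qed.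

Lemma coord_of_basis j : coord_of (e j) j = 1.
Proof.
rewrite (@coord_of_unique _ (fun i => (i == j)%:R)) ?eqxx //.
rewrite (bigD1 j) //= eqxx scale1r big1 ?addr0 // => i /negPf ->.
by rewrite scale0r.
Qed.

End Basis.

Lemma linear_sum_of (F : fieldType) (V W : lmodType F) (T : V -> W) n
    (c : 'I_n -> F) (e : 'I_n -> V) :
  linear T -> T (\sum_i c i *: e i) = \sum_i c i *: T (e i).
Proof.
move=> T_lin.
have T0 : T 0 = 0 by have := T_lin (-1) 0 0; rewrite scaler0 addr0 scaleN1r addNr.
elim: n c e => [|n IH] c e; first by rewrite !big_ord0.
by rewrite !big_ord_recl T_lin IH.
Qed.

Lemma jordan_basis_coord (F : fieldType) (V : lmodType F) (T : V -> V) r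
    (p : 'I_r -> nat) (l : 'I_r -> F) (e : 'I_(\sum_i p i) -> V)
    (he : is_basis e) :
  linear T -> is_jordan_basis T l e -> forall v i (k : 'I_(p i)),
  coord_of he (T v) (tagnat.Rank i k) =
  \sum_q jordan_block (p i) (l i) k q * coord_of he v (tagnat.Rank i q).
Proof.
move=> T_lin [_ _ TE] v i k.
pose M := \mxdiag_(i < r) jordan_block (p i) (l i).
have -> : coord_of he (T v) = fun a => \sum_b M a b * coord_of he v b.
  apply: coord_of_unique; rewrite {1}(coord_ofE he v) linear_sum_of //.
  transitivity (\sum_b \sum_a (coord_of he v b * M a b) *: e a).
    apply: eq_bigr => b _; rewrite TE scaler_sumr.
    by apply: eq_bigr => a _; rewrite scalerA.
  rewrite exchange_big; apply: eq_bigr => a _ /=; rewrite scaler_suml.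
  by apply: eq_bigr => b _; rewrite mulrC.
pose C : 'cV[F]_(\sum_i p i) := \col_b coord_of he v b.
have eC : \sum_b M (tagnat.Rank i k) b * coord_of he v b = (M *m C) (tagnat.Rank i k) 0.
  by rewrite [RHS]mxE; apply: eq_bigr => b _; rewrite [C b 0]mxE.
rewrite eC -[C]submxcolK mul_mxdiag_mxcol.
transitivity ((jordan_block (p i) (l i) *m submxcol C i) k 0).
  pose B i' := jordan_block (p i') (l i') *m submxcol C i'.
  apply: (etrans _ (congr1 (fun D : 'cV_(p i) => D k 0) (mxcolK B i))).
  by rewrite [RHS]mxE.
rewrite [LHS]mxE; apply: eq_bigr => q _; congr (_ * _).
by rewrite [LHS]mxE [LHS]mxE.
Qed.

Lemma jordan_block_mul_last (F : fieldType) n (k : 'I_n) (z : 'I_n -> F) :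
  k.+1 = n -> \sum_q jordan_block n 1 k q * z q = z k.
Proof.
move=> kn; rewrite (bigD1 k) //= big1 ?addr0 => [|q ne].
  by rewrite mxE eqxx gtn_eqF // addr0 mul1r.
rewrite mxE eq_sym (negPf ne) mulr0n add0r (_ : (_ == _) = false) ?mul0r //.
by apply/eqP; have := ltn_ord q; lia.
Qed.

Lemma jordan_block_mulS (F : fieldType) n (k k' : 'I_n) (z : 'I_n -> F) :
  k.+1 = k' -> \sum_q jordan_block n 1 k q * z q = z k + z k'.
Proof.
move=> kk'; have ne : k' != k by rewrite -val_eqE /=; apply/eqP; lia.
rewrite (bigD1 k) //= (bigD1 k') //= big1 ?addr0 => [|q /andP[nek nek']].
  by rewrite !mxE eqxx gtn_eqF // addr0 mul1r kk' eqxx eq_sym (negPf ne) add0r mul1r.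
rewrite mxE eq_sym (negPf nek) mulr0n add0r (_ : (_ == _) = false) ?mul0r //.
by apply/eqP; rewrite kk' => /val_inj e; case/eqP: nek'.
Qed.

(** The ones of [jordan_block] lie above the diagonal, so under [T] each coordinate of the block
    gains the next: the last is invariant and the last but one gains the last. *)
Lemma jordan_basis_functionals (F : fieldType) (V : lmodType F) (T : V -> V) r
    (p : 'I_r -> nat) (l : 'I_r -> F) (e : 'I_(\sum_i p i) -> V) i :
  linear T -> is_jordan_basis T l e -> l i = 1 -> (1 < p i)%N ->
  exists x y : V -> F,
    [/\ forall c u v, x (c *: u + v) = c * x u + x v,
        forall c u v, y (c *: u + v) = c * y u + y v,
        forall v, x (T v) = x v, forall v, y (T v) = y v + x v &
        exists v, x v != 0].
Proof.
move=> T_lin TJ li pi; have [he _ _] := TJ.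
have lt1 : ((p i).-1 < p i)%N by lia.
have lt2 : ((p i).-2 < p i)%N by lia.
have coordT := jordan_basis_coord he T_lin TJ.
pose x v := coord_of he v (tagnat.Rank i (Ordinal lt1)).
pose y v := coord_of he v (tagnat.Rank i (Ordinal lt2)).
exists x, y; split=> [c u v|c u v|v|v|].
- exact: coord_ofP.
- exact: coord_ofP.
- by rewrite /x coordT li jordan_block_mul_last //=; lia.
- by rewrite /y coordT li (jordan_block_mulS (k' := Ordinal lt1)) //=; lia.
by exists (e (tagnat.Rank i (Ordinal lt1))); rewrite /x coord_of_basis oner_eq0.
Qed.

(** * Extension of the two functionals from [N] to [G] *)

Section Extension.
Variables (F : numFieldType) (N G : groupType).
Variables (inc : {multiplicative N -> G}) (nu : {multiplicative G -> infcyc}).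
Hypothesis inc_nu : short_exact inc nu.
Variables (g : G) (conj_g : N -> N).
Hypothesis nu_g : nu g = (1 : int).
Hypothesis conj_gE : forall m, inc (conj_g m) = (g * inc m * g^-1)%g.
Variables a b : N -> F.
Hypothesis aM : forall x y, a (x * y)%g = a x + a y.
Hypothesis bM : forall x y, b (x * y)%g = b x + b y.
Hypothesis a_conj : forall m, a (conj_g m) = a m.
Hypothesis b_conj : forall m, b (conj_g m) = b m + a m.

Definition degree (x : G) : int := nu x.

Lemma degreeM x y : degree (x * y)%g = degree x + degree y.
Proof. by rewrite /degree gmulfM. Qed.

Lemma degree1 : degree 1%g = 0.
Proof. exact: (gmorph1 nu). Qed.

Lemma degreeV x : degree x^-1%g = - degree x.
Proof. by apply: (@addrI _ (degree x)); rewrite -degreeM mulgV degree1 subrr. Qed.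

Lemma degree_inc m : degree (inc m) = 0.
Proof. by have [_ _ h] := inc_nu; apply/h; exists m. Qed.

Lemma degree0_inc x : degree x = 0 -> exists m, inc m = x.
Proof. by have [_ _ h] := inc_nu; move=> /h. Qed.

Lemma conj_degree0 x y : degree y = 0 -> degree (x * y * x^-1)%g = 0.
Proof. by move=> y0; rewrite !degreeM degreeV y0 addr0 subrr. Qed.

(** Total, so that [preimage] takes no proof argument; its value outside degree 0 is arbitrary. *)
Lemma preimage_exists x : exists m, degree x = 0 -> inc m = x.
Proof.
have [/degree0_inc[m em]|ne] := eqVneq (degree x) 0; first by exists m.
by exists 1%g => e; rewrite e eqxx in ne.
Qed.

Definition preimage x : N := sval (cid (preimage_exists x)).

Lemma preimageE x : degree x = 0 -> inc (preimage x) = x.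
Proof. exact: (svalP (cid (preimage_exists x))). Qed.

Lemma preimage_unique x m : inc m = x -> preimage x = m.
Proof.
have [inj _ _] := inc_nu; move=> em; apply: inj.
by rewrite preimageE ?em // -em degree_inc.
Qed.

Lemma preimageM x y : degree x = 0 -> degree y = 0 ->
  preimage (x * y)%g = (preimage x * preimage y)%g.
Proof. by move=> x0 y0; apply: preimage_unique; rewrite gmulfM !preimageE. Qed.

(** An element of degree n should act on [a] and [b] as the n-th power of the monodromy. *)
Let conj_rule x := forall y, degree y = 0 ->
  a (preimage (x * y * x^-1)%g) = a (preimage y) /\
  b (preimage (x * y * x^-1)%g) = b (preimage y) + (degree x)%:~R * a (preimage y).

Lemma conj_rule_gen : conj_rule g.
Proof.
move=> y y0; have -> : preimage (g * y * g^-1)%g = conj_g (preimage y).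
  by apply: preimage_unique; rewrite conj_gE preimageE.
by rewrite a_conj b_conj /degree nu_g mul1r.
Qed.

Lemma conj_rule_degree0 x : degree x = 0 -> conj_rule x.
Proof.
move=> x0 y y0; have xy0 := conj_degree0 x y0.
have e : (preimage (x * y * x^-1)%g * preimage x = preimage x * preimage y)%g.
  by rewrite -!preimageM // mulgVK.
rewrite x0 mul0r addr0; split.
  by apply: (@addIr _ (a (preimage x))); rewrite -aM e aM addrC.
by apply: (@addIr _ (b (preimage x))); rewrite -bM e bM addrC.
Qed.

Lemma conj_ruleM x y : conj_rule x -> conj_rule y -> conj_rule (x * y)%g.
Proof.
move=> hx hy z z0; have [ey1 ey2] := hy z z0.
have [ex1 ex2] := hx _ (conj_degree0 y z0).
have -> : (x * y * z * (x * y)^-1 = x * (y * z * y^-1) * x^-1)%g.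
  by rewrite invgM !mulgA.
rewrite ex1 ex2 ey1 ey2 degreeM rmorphD mulrDl -addrA.
by split=> //; congr (_ + _); rewrite addrC.
Qed.

Lemma conj_ruleV x : conj_rule x -> conj_rule x^-1%g.
Proof.
move=> hx y y0; have := hx _ (conj_degree0 x^-1%g y0); rewrite invgK.
have -> : (x * (x^-1 * y * x) * x^-1 = y)%g by rewrite !mulgA mulgK mulgV mul1g.
move=> [e1 e2]; split=> //.
by rewrite e2 e1 degreeV rmorphN mulNr addrK.
Qed.

Let posS n : Posz n.+1 = Posz n + 1. Proof. by rewrite intS addrC. Qed.

Lemma conj_ruleP x : conj_rule x.
Proof.
have [k] : exists k, k = degree x by exists (degree x).
elim/int_rect: k x => [|n IH|n IH] x ex; first exact: conj_rule_degree0.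
  rewrite -[x](mulgVK g); apply: conj_ruleM conj_rule_gen; apply: IH.
  by rewrite degreeM degreeV -ex /degree nu_g posS addrK.
rewrite -[x](mulgK g); apply: conj_ruleM (conj_ruleV conj_rule_gen); apply: IH.
by rewrite degreeM -ex /degree nu_g posS opprD addrNK.
Qed.

Definition gen_power (k : int) : G :=
  match k with Posz n => (g ^+ n)%g | Negz n => (g ^- n.+1)%g end.

Lemma gen_powerS k : gen_power (k + 1) = (gen_power k * g)%g.
Proof.
case: k => [n|[|n]]; rewrite ?NegzE.
- by rewrite -PoszD addn1 /= expgSr.
- by rewrite addNr /= expg0 expg1 mulVg.
- rewrite (_ : - n.+2%:Z + 1 = Negz n) /=; last by rewrite NegzE; lia.
  by rewrite [in RHS]expgS invgM mulgVK.
Qed.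

Lemma gen_powerD k l : gen_power (k + l) = (gen_power k * gen_power l)%g.
Proof.
elim/int_rect: l => [|n IH|n IH]; first by rewrite addr0 /= expg0 mulg1.
  by rewrite posS addrA !gen_powerS IH mulgA.
apply: (@mulIg _ g); rewrite -mulgA -!gen_powerS -addrA.
by rewrite posS opprD addrNK.
Qed.

Lemma degree_gen_power k : degree (gen_power k) = k.
Proof.
elim/int_rect: k => [|n IH|n IH]; first exact: degree1.
  by rewrite posS gen_powerS degreeM IH /degree nu_g.
apply: (@addIr _ 1); rewrite -{1}nu_g -degreeM -gen_powerS.
by rewrite posS opprD addrNK.
Qed.

(** The [N] part of [x] when [G] is split as a semidirect product by the powers of [g]. *)
Definition kernel_part x := (x * (gen_power (degree x))^-1)%g.

Lemma degree_kernel_part x : degree (kernel_part x) = 0.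
Proof. by rewrite degreeM degreeV degree_gen_power subrr. Qed.

Lemma kernel_partM x y : kernel_part (x * y)%g =
  (kernel_part x * (gen_power (degree x) * kernel_part y * (gen_power (degree x))^-1))%g.
Proof. by rewrite /kernel_part degreeM gen_powerD invgM !mulgA mulgVK. Qed.

(** Evaluate [a] and [b] on the [N] part. In a product [x * y] the [N] part of [y] gets conjugated
    by g^(degree x), which fixes [a] and produces the extra term of [beta]. *)
Lemma unipotent_extension : exists alpha beta : G -> F,
  [/\ forall x y, alpha (x * y)%g = alpha x + alpha y,
      forall x y, beta (x * y)%g =
        beta x + beta y + (degree x)%:~R * alpha y &
      forall m, alpha (inc m) = a m].
Proof.
exists (a \o preimage \o kernel_part), (b \o preimage \o kernel_part).
split=> [x y|x y|m] /=.
- rewrite kernel_partM preimageM ?conj_degree0 ?degree_kernel_part // aM.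
  by have [-> _] := conj_ruleP (gen_power (degree x)) (degree_kernel_part y).
- rewrite kernel_partM preimageM ?conj_degree0 ?degree_kernel_part // bM.
  have [_ ->] := conj_ruleP (gen_power (degree x)) (degree_kernel_part y).
  by rewrite degree_gen_power addrA.
congr a; apply: preimage_unique.
by rewrite /kernel_part degree_inc /= expg0 invg1 mulg1.
Qed.

End Extension.

Lemma H1_classM (K : fieldType) (G : groupType) (x y : G) :
  qproj (boundary1 K G) << (x * y)%g >> =
  qproj (boundary1 K G) << x >> + qproj (boundary1 K G) << y >>.
Proof.
rewrite -linearD; apply/esym/qprojP; exists << (x, y) >> => //.
by rewrite /bar_d2 malg_liftU /= addrAC [<< y >> + _]addrC.
Qed.

Lemma H1_map_class (K : fieldType) (G H : groupType) (f : {multiplicative G -> H}) x :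
  H1_map K f (qproj _ << x >>) = qproj _ << f x >>.
Proof. by rewrite H1_mapE /malg_map malg_liftU. Qed.

Lemma H1_map_linear (K : fieldType) (G H : groupType) (f : {multiplicative G -> H}) :
  linear (H1_map K f).
Proof.
move=> c x y; have [a ->] := qproj_surj x; have [b ->] := qproj_surj y.
by rewrite -linearP !H1_mapE !linearP.
Qed.

Theorem theorem1p1 (R : realType) (N G K pi : groupType)
    (inc : {multiplicative N -> G}) (nu : {multiplicative G -> infcyc})
    (jnc : {multiplicative K -> pi}) (chi : {multiplicative pi -> G}) :
  short_exact inc nu -> short_exact jnc chi ->
  b1_finite R[i] N -> b1_finite R[i] K ->
  finitely_presented pi -> one_formal pi ->
  forall (g : G) (conj_g : {multiplicative N -> N}),
    nu g = (1 : int) ->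
    (forall m : N, inc (conj_g m) = (g * inc m * g^-1)%g) ->
    is_eigenvalue (H1_map R[i] conj_g) 1 ->
    jordan_blocks_of_size1 (H1_map R[i] conj_g) 1.
Proof.
move=> inc_nu jnc_chi finN finK _ formal g conj_g nu_g conj_gE _ r p l e TJ i li.
have [_ p_gt0 _] := TJ.
have [le1|p_gt1] := leqP (p i) 1; first by apply/eqP; rewrite eqn_leq le1 p_gt0.
have [x [y [xP yP xT yT [v xv]]]] :=
  jordan_basis_functionals (H1_map_linear (K := R[i]) conj_g) TJ li p_gt1.
pose cls m := qproj (boundary1 R[i] N) << m >>.
have addP (h : H1 R[i] N -> R[i]) : (forall c u w, h (c *: u + w) = c * h u + h w) ->
    forall m m', h (cls (m * m')%g) = h (cls m) + h (cls m').
  by move=> hP m m'; rewrite /cls H1_classM -[X in X + _]scale1r hP mul1r.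
(* Classes of elements of [N] span the homology, so [x] cannot vanish on all of them. *)
have [m0 xm0] : exists m, x (cls m) != 0.
  apply: contrapT => h; case/eqP: xv; have [c ->] := qproj_surj v.
  have x0 : x 0 = 0 by have := xP (-1) 0 0; rewrite scaler0 addr0 mulN1r addNr.
  have P0 : x (qproj (boundary1 R[i] N) 0) = 0 by rewrite linear0.
  have PP d u w : x (qproj (boundary1 R[i] N) u) = 0 ->
      x (qproj (boundary1 R[i] N) w) = 0 ->
      x (qproj (boundary1 R[i] N) (d *: u + w)) = 0.
    by move=> u0 w0; rewrite linearP xP u0 w0 mulr0 addr0.
  apply: (malg_subspace_ind (U := Subspace P0 PP)) => m /=.
  by apply/eqP/negPn/negP => xm; apply: h; exists m.
have [alpha [beta [alphaM betaM alphaE]]] := unipotent_extension inc_nu nu_g conj_gE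
  (addP x xP) (addP y yP)
  (fun m => etrans (congr1 x (esym (H1_map_class _ conj_g m))) (xT _))
  (fun m => etrans (congr1 y (esym (H1_map_class _ conj_g m))) (yT _)).
pose deg (q : pi) : rat^o := (degree nu (chi q))%:~R.
have deg0 q : deg q = 0 <-> exists m, inc m = chi q.
  split=> [/eqP|[m em]]; last by rewrite /deg -em (degree_inc inc_nu).
  by rewrite intr_eq0 => /eqP; apply: (degree0_inc inc_nu).
have [_ chi_surj _] := jnc_chi.
have [t et] := chi_surj g; have [q0 eq0] := chi_surj (inc m0).
have degM a b : deg (a * b)%g = deg a + deg b by rewrite /deg gmulfM degreeM rmorphD.
have alphaM' a b : (alpha \o chi) (a * b)%g = (alpha \o chi) a + (alpha \o chi) b.
  by rewrite /= gmulfM alphaM.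
have betaM' a b : (beta \o chi) (a * b)%g =
    (beta \o chi) a + (beta \o chi) b + ratr (deg a) * (alpha \o chi) b.
  by rewrite /= gmulfM betaM ratr_int.
have deg_t : deg t = 1 by rewrite /deg et /degree nu_g.
have deg_q0 : deg q0 = 0 by apply/deg0; exists m0.
have alpha_q0 : (alpha \o chi) q0 != 0 by rewrite /= eq0 alphaE.
have [u [uM u_free]] :=
  one_formal_independent degM alphaM' betaM' formal deg_t deg_q0 alpha_q0.
have [inc_inj _ _] := inc_nu.
have uM' k a b : (exists m, inc m = chi a) -> (exists m, inc m = chi b) ->
    u k (a * b)%g = u k a + u k b by move=> /deg0 a0 /deg0 b0; apply: uM.
(* Finiteness of both b_1 yields a nontrivial relation on the kernel of [deg], against [u_free]. *)
have [d [c [c0 [k kd /eqP]]]] := extension_dependent inc_inj jnc_chi finN finK uM'.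
by case; apply: (u_free d) => // m /deg0; apply: c0.
Qed.
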